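(* Let $CS(n,x)$ denote the number of lozenge tilings of the region $H_{n,x}$ that are invariant under rotation by $120^\circ$ around its center. For all integers $n,x\ge1$ we have $$CS(2n,2x+1)=\frac{n!\,(x-1)!}{(2n)!}\left(\prod_{i=0}^{n}\frac{(x+2i)_{i+1}}{(x+n+i)!}\right)\prod_{i=0}^{n-1}\frac{[i!]^2\,[(2x+2i+2)_{i+1}]^2\,(x+i)!\,(x+2i+1)_i}{[(2i)!]^2}$$ and $$CS(2n-1,2x+1)=\frac{(x-1)!\,(2x+2n)_n}{(x+n-1)!}\prod_{i=0}^{n-1}\frac{[i!]^2\,[(2x+2i)_{i}]^2\,(x+i)!\,(x+2i)_{i+1}\,(x+2i+1)_i}{[(2i)!]^2\,(x+n+i)!}.$$
   Context: $(a)_k:=a(a+1)\cdots(a+k-1)$ is the shifted factorial, with $(a)_0=1$. Work in the regular triangular lattice with unit side. A lozenge is a unit rhombus that is the union of two unit triangles of the lattice sharing an edge; a lozenge tiling of a region (a finite union of unit triangles) is a covering of it by lozenges contained in it, without gaps or overlaps. For integers $n\ge1$, $x\ge0$, $H_{n,x}$ is obtained as follows. Take the lattice hexagon with all angles $120^\circ$ and side lengths $n,n+x,n,n+x,n,n+x$ in cyclic order, and remove from its center the triangular lattice region of side $x$ whose vertices point towards the shorter sides (those of length $n$) of the hexagon. (Equivalently: take a lattice equilateral triangle of side $3n+x$, cut off the three corner triangles of side $n$, and remove the concentric triangle of side $x$ with the same orientation as the large triangle.) *)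

(* Defs.v *)
From mathcomp Require Import all_boot all_order all_algebra.

Set Implicit Arguments.
Unset Strict Implicit.
Unset Printing Implicit Defensive.

(* A lattice equilateral triangle of side N is placed in integer barycentric
   coordinates: its points are the (p, q, r) >= 0 with p + q + r = N, and its
   lattice lines are the loci where one coordinate is an integer.  A unit
   triangle is recorded by the integer parts (a, b, c) of the coordinates of
   its interior points, so it lies in the strips
     a <= p <= a + 1,   b <= q <= b + 1,   c <= r <= c + 1.
   It points the same way as the large triangle when a + b + c = N - 1
   (vertices (a+1,b,c), (a,b+1,c), (a,b,c+1)) and the opposite way when
   a + b + c = N - 2 (vertices (a,b+1,c+1), (a+1,b,c+1), (a+1,b+1,c)); the
   other triples of [cell N] are not unit triangles. *)
Notation cell N := ('I_N * 'I_N * 'I_N)%type.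

Definition up (N : nat) (t : cell N) : bool :=
  let: (a, b, c) := t in a + b + c + 1 == N.

Definition down (N : nat) (t : cell N) : bool :=
  let: (a, b, c) := t in a + b + c + 2 == N.

(* The three edges of an up triangle u separate it from the down triangles
   obtained by lowering one of its coordinates by 1. *)
Definition share_edge (N : nat) (u d : cell N) : bool :=
  let: (a, b, c) := u in
  let: (a', b', c') := d in
  [|| [&& a == a' + 1 :> nat, b == b' & c == c'],
      [&& a == a', b == b' + 1 :> nat & c == c']
    | [&& a == a', b == b' & c == c' + 1 :> nat]].

Definition lozenge (N : nat) (L : {set cell N}) : bool :=
  [exists u : cell N, exists d : cell N,
    [&& up u, down d, share_edge u d & L == [set u; d]]].

Definition tiling (N : nat) (D : {set cell N}) (P : {set {set cell N}}) : bool :=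
  partition P D && [forall L in P, lozenge L].

(* The rotation by 120 degrees around the center of the large triangle permutes
   the three barycentric coordinates cyclically. *)
Definition rot120 (N : nat) (t : cell N) : cell N :=
  let: (a, b, c) := t in (b, c, a).

Definition rot_invariant (N : nat) (P : {set {set cell N}}) : bool :=
  [set @rot120 N @: L | L : {set cell N} in P] == P.

(* H_{n,x}, inside the triangle of side 3n + x: the corner triangles of side n
   are p >= 2n + x, q >= 2n + x, r >= 2n + x, and the concentric triangle of
   side x is p, q, r >= n. *)
Definition Hregion (n x : nat) : {set cell (3 * n + x)} :=
  [set t : cell (3 * n + x) | (up t || down t) &&
    (let: (a, b, c) := t in
     [&& a < 2 * n + x, b < 2 * n + x & c < 2 * n + x] &&
     ~~ [&& n <= a, n <= b & n <= c])].

Definition CS (n x : nat) : nat :=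
  #|[set P : {set {set cell (3 * n + x)}} |
      tiling (Hregion n x) P && rot_invariant P]|.

Definition poch (R : pzSemiRingType) (a : R) (k : nat) : R :=
  (\prod_(j < k) (a + j%:R))%R.

(* Main.v *)
(* A rotation-invariant tiling is determined by its restriction to the third
   a < n <= b of the region, an n x (n + x) parallelogram in which every cell
   (i, j) holds one up and one down triangle.  Sending the up triangle of a cell
   to the cell of the down triangle matched with it (modulo rotation) turns
   invariant tilings into the permutations of the grid whose moves are: stay,
   decrease i, decrease j, or wrap from (i, 0) to (n - 1, n + x - 1 - i).
   The nontrivial cycles of such a permutation do not cross, so each of them wraps
   exactly once; weighting the wraps by 1 and the other moves by -1 therefore
   cancels the signs, and the number of tilings is a determinant, which reduces
   to det (1 + B) with B = (C(x + i + j, j))_(i, j < n).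

   For x replaced by 2x + 1, Vandermonde convolution factors B as P Q, where P and Q
   are both (up to signs) substitutions t -> -1 - t on polynomials.  In bases of
   polynomials which are even or odd under this substitution, 1 + B becomes block
   diagonal.  Both blocks are, up to diagonal factors, the matrix
     (a + b + v)! / ((2a + v - b)! (2b - a + 1)!)
   for v = x + 2 and v = x + 1, and this matrix has an LU decomposition whose
   triangular factors are hypergeometric; the identities needed for it are
   first-order recurrences obtained by creative telescoping. *)
Require Import Defs.
From mathcomp Require Import all_boot all_order all_fingroup all_algebra.
From mathcomp Require Import zify ring lra.
Import Order.TTheory GRing.Theory Num.Theory.
Set Implicit Arguments.
Unset Strict Implicit.
Unset Printing Implicit Defensive.

(** * Invariant tilings as permutations of a grid *)

Section SymmetricTilings.

(* The cyclic group K acts freely on the cells of D through its generator r, and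
   G indexes both the orbits of up cells and those of down cells. *)
Variables (T G : finType) (K : finZmodType) (r : K).
Variables (D : {set T}) (rot : T -> T) (loz : pred {set T}).
Variables (cu cd : G -> K -> T) (e : G -> G -> K -> bool).
Local Open Scope ring_scope.
Hypothesis r_gen : forall k, exists i, k = r *+ i.
Hypothesis rot_cu : forall z k, rot (cu z k) = cu z (k + r).
Hypothesis rot_cd : forall z k, rot (cd z k) = cd z (k + r).
Hypothesis cu_inj : forall z k z' k', cu z k = cu z' k' -> z = z' /\ k = k'.
Hypothesis cd_inj : forall z k z' k', cd z k = cd z' k' -> z = z' /\ k = k'.
Hypothesis cu_cd : forall z k z' k', cu z k <> cd z' k'.
Hypothesis cuD : forall z k, cu z k \in D.
Hypothesis cdD : forall z k, cd z k \in D.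
Hypothesis D_cover : forall t, t \in D ->
  (exists z k, t = cu z k) \/ (exists z k, t = cd z k).
Hypothesis loz_inv : forall L : {set T}, L \subset D -> loz L ->
  exists z k z' k', e z z' (k' - k) /\ L = [set cu z k; cd z' k'].
Hypothesis loz_edge : forall z k z' k', e z z' (k' - k) -> loz [set cu z k; cd z' k'].
Hypothesis e_inj : forall z z' k k', e z z' k -> e z z' k' -> k = k'.

(** By [e_inj] at most one relative rotation joins two given orbits; 0 is a default for orbits that
    are not joined. *)
Definition turn z z' : K := odflt 0 [pick k | e z z' k].

Definition perm_edge (s : {perm G}) := [forall z, [exists k, e z (s z) k]].

Definition perm_tile (s : {perm G}) (zk : G * K) : {set T} :=
  [set cu zk.1 zk.2; cd (s zk.1) (zk.2 + turn zk.1 (s zk.1))].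

Definition perm_tiling (s : {perm G}) : {set {set T}} :=
  [set perm_tile s zk | zk in [set: G * K]].

Definition sym_tilings : {set {set {set T}}} :=
  [set P | partition P D && [forall L in P, loz L]
           && ([set rot @: (L : {set T}) | L : {set T} in P] == P)].

Lemma turnP s z : perm_edge s -> e z (s z) (turn z (s z)).
Proof.
move=> /forallP/(_ z)/existsP[k ek]; rewrite /turn.
by case: pickP => [//|/(_ k)]; rewrite ek.
Qed.

Lemma turnE z z' k : e z z' k -> turn z z' = k.
Proof.
move=> ek; rewrite /turn; case: pickP => [k' ek' /=|/(_ k)]; last by rewrite ek.
exact: e_inj ek' ek.
Qed.

Lemma pair_inj z k z1 k1 z' k' z1' k1' :
  [set cu z k; cd z' k'] = [set cu z1 k1; cd z1' k1'] ->
  [/\ z = z1, k = k1, z' = z1' & k' = k1'].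
Proof.
move=> E.
have : cu z k \in [set cu z1 k1; cd z1' k1'] by rewrite -E !inE eqxx.
rewrite !inE => /orP[]/eqP; last by move/cu_cd.
move=> /cu_inj[-> ->].
have : cd z' k' \in [set cu z1 k1; cd z1' k1'] by rewrite -E !inE eqxx orbT.
rewrite !inE => /orP[]/eqP; first by move/esym/cu_cd.
by move=> /cd_inj[-> ->].
Qed.

Lemma rot_pair z k z' k' :
  rot @: [set cu z k; cd z' k'] = [set cu z (k + r); cd z' (k' + r)].
Proof. by rewrite imsetU1 imset_set1 rot_cu rot_cd. Qed.

Lemma perm_tile_disjoint s u v t :
  t \in perm_tile s u -> t \in perm_tile s v -> u = v.
Proof.
case: u v => [z k] [z' k']; rewrite !inE /= => /orP[]/eqP-> /orP[]/eqP.
- by move=> /cu_inj[-> ->].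
- by move/cu_cd.
- by move/esym/cu_cd.
- by move=> /cd_inj[/perm_inj-> /addIr->].
Qed.

Lemma perm_tiling_partition s : partition (perm_tiling s) D.
Proof.
apply/and3P; split.
- rewrite eqEsubset; apply/andP; split; apply/subsetP => t.
    by case/bigcupP => _ /imsetP[[z k] _ ->]; rewrite !inE => /orP[]/eqP->.
  move=> tD; apply/bigcupP; case: (D_cover tD) => -[z [k ->]].
    by exists (perm_tile s (z, k)); [rewrite imset_f | rewrite !inE eqxx].
  pose z0 := (s^-1)%g z; exists (perm_tile s (z0, k - turn z0 z)).
    by rewrite imset_f.
  by rewrite !inE /= /z0 permKV subrK eqxx orbT.
- apply/trivIsetP => _ _ /imsetP[u _ ->] /imsetP[v _ ->] nuv.
  rewrite -setI_eq0; apply/eqP/setP => t; rewrite in_setI in_set0.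
  apply/negP => /andP[tu tv]; case/negP: nuv.
  by rewrite (perm_tile_disjoint tu tv).
- apply/imsetP => -[[z k] _ /setP/(_ (cu z k))].
  by rewrite !inE eqxx.
Qed.

Lemma perm_tiling_sym s : perm_edge s -> perm_tiling s \in sym_tilings.
Proof.
move=> es; rewrite inE perm_tiling_partition /=; apply/andP; split.
  apply/forall_inP => _ /imsetP[[z k] _ ->]; apply: loz_edge => /=.
  by rewrite addrAC subrr add0r turnP.
apply/eqP/setP => L; apply/imsetP/imsetP.
  move=> [_ /imsetP[[z k] _ ->] ->]; exists (z, k + r) => //.
  by rewrite /perm_tile rot_pair /= addrAC.
move=> [[z k] _ ->]; exists (perm_tile s (z, k - r)); first by rewrite imset_f.
by rewrite /perm_tile rot_pair /= (addrAC _ (turn _ _)) subrK.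
Qed.

Lemma perm_tiling_inj : {in perm_edge &, injective perm_tiling}.
Proof.
move=> s t _ _ E; apply/permP => z.
have : perm_tile s (z, 0) \in perm_tiling t by rewrite -E imset_f.
by case/imsetP => -[z1 k1] _ /pair_inj[/= -> _ -> _].
Qed.

(** A block of [P] is nonempty, so it meets some block of [Q], which belongs to [P] as well;
    disjointness identifies the two. *)
Lemma partition_subset_eq (P Q : {set {set T}}) :
  partition P D -> partition Q D -> Q \subset P -> P = Q.
Proof.
move=> /and3P[/eqP cP tP P0] /and3P[/eqP cQ _ _] /subsetP QP.
apply/eqP; rewrite eqEsubset; apply/andP; split; last exact/subsetP.
apply/subsetP => L LP.
case: (set_0Vmem L) => [L0|[t tL]]; first by rewrite L0 (negbTE P0) in LP.
have : t \in cover Q by rewrite cQ -cP; apply/bigcupP; exists L.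
case/bigcupP => M MQ tM.
by rewrite -(def_pblock tP LP tL) (def_pblock tP (QP _ MQ) tM).
Qed.

Lemma sym_tiling_perm P : P \in sym_tilings ->
  exists2 s, perm_edge s & P = perm_tiling s.
Proof.
rewrite inE => /andP[/andP[pP /forall_inP lP] /eqP rP].
have /and3P[/eqP cP tP P0] := pP.
(* Invariance under the generator propagates to all of [K]. *)
have rotP z k z' k' j : [set cu z k; cd z' k'] \in P ->
    [set cu z (k + j); cd z' (k' + j)] \in P.
  move=> H; have [i ->] := r_gen j; elim: i => [|i IH].
    by rewrite mulr0n !addr0.
  by rewrite -rP; apply/imsetP; eexists; [exact: IH|]; rewrite rot_pair mulrSr !addrA.
have sub L : L \in P -> L \subset D by move=> LP; rewrite -cP bigcup_sup.
have /fin_all_exists[f fP] : forall z, exists zk : G * K,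
    e z zk.1 zk.2 /\ [set cu z 0; cd zk.1 zk.2] \in P.
  move=> z; have : cu z 0 \in cover P by rewrite cP.
  case/bigcupP => L LP zL.
  have [z1 [k1 [z' [k' [ek E]]]]] := loz_inv (sub _ LP) (lP _ LP).
  move: zL; rewrite E !inE => /orP[]/eqP; last by move/cu_cd.
  move=> /cu_inj[zE kE]; subst z1 k1; exists (z', k'); split => /=.
    by move: ek; rewrite subr0.
  by rewrite -E.
(* If two up orbits were matched with the same down orbit, a rotated copy of one lozenge would share
   a down cell with the other, hence equal it. *)
have f_inj : injective (fun z => (f z).1).
  move=> z z' /= E.
  have [_ H] := fP z; have [_ H'] := fP z'.
  have := rotP _ _ _ _ ((f z').2 - (f z).2) H.
  rewrite E add0r (addrC (f z).2) subrK => H1.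
  have E1 := def_pblock tP H1 (_ : cd (f z').1 (f z').2 \in _).
  have E2 := def_pblock tP H' (_ : cd (f z').1 (f z').2 \in _).
  have := E1 (set22 _ _); rewrite E2 ?set22 //.
  by case/pair_inj.
exists (perm f_inj).
  apply/forallP => z; apply/existsP; exists (f z).2; rewrite permE.
  by case: (fP z).
apply: partition_subset_eq => //; first exact: perm_tiling_partition.
apply/subsetP => _ /imsetP[[z k] _ ->]; rewrite /perm_tile /= permE.
have [ek H] := fP z; rewrite (turnE ek) addrC.
by have := rotP _ _ _ _ k H; rewrite add0r.
Qed.

Lemma card_sym_tilings : #|sym_tilings| = #|[set s | perm_edge s]|.
Proof.
rewrite -(card_in_imset (f := perm_tiling) (D := mem [set s | perm_edge s])).
  apply: eq_card => P; apply/idP/imsetP => [/sym_tiling_perm[s es ->]|[s]].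
    by exists s; rewrite ?inE.
  by rewrite inE => es ->; apply: perm_tiling_sym.
by move=> s t; rewrite !inE; apply: perm_tiling_inj.
Qed.

End SymmetricTilings.

(** * Coordinates on a fundamental third of the holey hexagon *)

Section HexagonCells.

Variables (n x : nat).
Notation N := (3 * n + x).
Notation grid := ('I_n * 'I_(n + x))%type.

Lemma grid_row_lt (z : grid) : z.1 < N.
Proof. have := ltn_ord z.1; lia. Qed.

Lemma grid_col_lt (z : grid) : n + z.2 < N.
Proof. have := ltn_ord z.2; have := ltn_ord z.1; lia. Qed.

Lemma grid_up_lt (z : grid) : 2 * n + x - 1 - z.1 - z.2 < N.
Proof. have := ltn_ord z.2; have := ltn_ord z.1; lia. Qed.

Lemma grid_down_lt (z : grid) : 2 * n + x - 2 - z.1 - z.2 < N.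
Proof. have := ltn_ord z.2; have := ltn_ord z.1; lia. Qed.

(** In the third a < n <= b the coordinates are a = i and b = n + j, and the sum forces c. The
    truncated subtractions are exact because i + j <= 2n + x - 2. *)
Definition up_cell (z : grid) (k : 'I_3) : cell N :=
  iter k (@rot120 N)
    (Ordinal (grid_row_lt z), Ordinal (grid_col_lt z), Ordinal (grid_up_lt z)).

Definition down_cell (z : grid) (k : 'I_3) : cell N :=
  iter k (@rot120 N)
    (Ordinal (grid_row_lt z), Ordinal (grid_col_lt z), Ordinal (grid_down_lt z)).

Definition grid_edge (z z' : grid) (k : 'I_3) : bool :=
  share_edge (up_cell z ord0) (down_cell z' k).

(** The last case is the edge at b = n: lowering b leaves the third, and the down triangle (i, n -
    1, 2n + x - 1 - i) found there is the cell (n - 1, n + x - 1 - i) rotated twice. *)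
Definition grid_step (z z' : grid) : bool :=
  [|| (z.1 == z'.1 :> nat) && (z.2 == z'.2 :> nat),
      (z.1 == z'.1.+1 :> nat) && (z.2 == z'.2 :> nat),
      (z.1 == z'.1 :> nat) && (z.2 == z'.2.+1 :> nat)
    | [&& z.2 == 0 :> nat, z'.1.+1 == n & z.1 + z'.2 == n + x - 1]].

Lemma ord3P (P : 'I_3 -> Prop) :
  P (inord 0) -> P (inord 1) -> P (inord 2) -> forall k, P k.
Proof.
move=> P0 P1 P2 [[|[|[|//]]] lt3].
- by congr (P _): P0; apply: val_inj; rewrite /= inordK.
- by congr (P _): P1; apply: val_inj; rewrite /= inordK.
- by congr (P _): P2; apply: val_inj; rewrite /= inordK.
Qed.

Lemma cell_eqE M (a b c a' b' c' : 'I_M) :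
  ((a, b, c) == (a', b', c') :> cell M) =
  [&& a == a' :> nat, b == b' :> nat & c == c' :> nat].
Proof. by rewrite !xpair_eqE -!val_eqE andbA. Qed.

Lemma rot120K M : cancel (@rot120 M) (fun t => rot120 (rot120 t)).
Proof. by case=> [[a b] c]. Qed.

Lemma rot120_inj M : injective (@rot120 M).
Proof. exact: can_inj (@rot120K M). Qed.

Lemma share_edge_rot M (u d : cell M) :
  share_edge (rot120 u) (rot120 d) = share_edge u d.
Proof.
case: u d => [[a b] c] [[a' b'] c'] /=; rewrite -!val_eqE /=; lia.
Qed.

Lemma up_rot M (u : cell M) : up (rot120 u) = up u.
Proof. case: u => [[a b] c] /=; lia. Qed.

Lemma down_rot M (u : cell M) : down (rot120 u) = down u.
Proof. case: u => [[a b] c] /=; lia. Qed.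

Lemma Hregion_rot (t : cell N) : (rot120 t \in Hregion n x) = (t \in Hregion n x).
Proof. by rewrite !inE up_rot down_rot; case: t => [[a b] c] /=; lia. Qed.

Lemma rot_up_cell z k : rot120 (up_cell z k) = up_cell z (k + inord 1)%R.
Proof.
move: k; apply: ord3P; rewrite /up_cell /= ?inordK //=.
Qed.

Lemma rot_down_cell z k : rot120 (down_cell z k) = down_cell z (k + inord 1)%R.
Proof.
move: k; apply: ord3P; rewrite /down_cell /= ?inordK //=.
Qed.

Lemma up_cell_up z k : up (up_cell z k).
Proof.
rewrite /up_cell; elim: (nat_of_ord k) => [|i IH]; last by rewrite iterS up_rot.
have := ltn_ord z.2; have := ltn_ord z.1; rewrite /=; lia.
Qed.

Lemma down_cell_down z k : down (down_cell z k).
Proof.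
rewrite /down_cell; elim: (nat_of_ord k) => [|i IH]; last by rewrite iterS down_rot.
have := ltn_ord z.2; have := ltn_ord z.1; rewrite /=; lia.
Qed.

Lemma up_down_cell z k z' k' : up_cell z k <> down_cell z' k'.
Proof.
move=> E; have := up_cell_up z k; have := down_cell_down z' k'.
by rewrite -E; case: (up_cell z k) => [[a b] c] /=; lia.
Qed.

Hypothesis x_gt0 : 0 < x.

Lemma up_cell_region z k : up_cell z k \in Hregion n x.
Proof.
rewrite /up_cell; elim: (nat_of_ord k) => [|i IH]; last by rewrite iterS Hregion_rot.
rewrite inE; have := ltn_ord z.2; have := ltn_ord z.1; rewrite /=; lia.
Qed.

Lemma down_cell_region z k : down_cell z k \in Hregion n x.
Proof.
rewrite /down_cell; elim: (nat_of_ord k) => [|i IH]; last by rewrite iterS Hregion_rot.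
rewrite inE; have := ltn_ord z.2; have := ltn_ord z.1; rewrite /=; lia.
Qed.

Lemma up_cell_inj z k z' k' : up_cell z k = up_cell z' k' -> z = z' /\ k = k'.
Proof.
move=> /eqP; have := ltn_ord z.2; have := ltn_ord z.1.
have := ltn_ord z'.2; have := ltn_ord z'.1.
case: z z' => [i j] [i' j'] /=; rewrite /up_cell.
move: k; apply: ord3P; move: k'; apply: ord3P; rewrite ?inordK //= cell_eqE /= => *;
  by [split=> //; congr (_, _); apply: val_inj => /=; lia | exfalso; lia].
Qed.

Lemma down_cell_inj z k z' k' : down_cell z k = down_cell z' k' -> z = z' /\ k = k'.
Proof.
move=> /eqP; have := ltn_ord z.2; have := ltn_ord z.1.
have := ltn_ord z'.2; have := ltn_ord z'.1.
case: z z' => [i j] [i' j'] /=; rewrite /down_cell.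
move: k; apply: ord3P; move: k'; apply: ord3P; rewrite ?inordK //= cell_eqE /= => *;
  by [split=> //; congr (_, _); apply: val_inj => /=; lia | exfalso; lia].
Qed.

Lemma region_cover_base (a b c : 'I_N) : a < n <= b -> (a, b, c) \in Hregion n x ->
  (exists z, (a, b, c) = up_cell z ord0) \/ (exists z, (a, b, c) = down_cell z ord0).
Proof.
move=> /andP[an nb]; rewrite inE => /andP[ud H].
have bn : b - n < n + x by lia.
pose z : grid := (Ordinal an, Ordinal bn).
case/orP: ud => /= ud; [left|right]; exists z; apply/eqP; rewrite /up_cell /down_cell /=;
  rewrite cell_eqE /=; lia.
Qed.

(** The coordinates sum to at least 3n + x - 2, so not all are below n, and the removed triangle
    excludes that all are at least n. Hence in cyclic order some coordinate below n is followed by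
    one that is at least n. *)
Lemma region_cover (t : cell N) : t \in Hregion n x ->
  (exists z k, t = up_cell z k) \/ (exists z k, t = down_cell z k).
Proof.
move=> tD.
have base (s : cell N) : s \in Hregion n x -> (let: (a, b, c) := s in a < n <= b) ->
    (exists z k, s = up_cell z k) \/ (exists z k, s = down_cell z k).
  case: s => [[a b] c] sD ab.
  by case: (region_cover_base ab sD) => -[z ->]; [left|right]; exists z, ord0.
have back s : (exists z k, rot120 s = up_cell z k) \/ (exists z k, rot120 s = down_cell z k) ->
    (exists z k, s = up_cell z k) \/ (exists z k, s = down_cell z k).
  case=> -[z [k E]]; [left|right]; exists z, (k - inord 1)%R;
    by apply: rot120_inj; rewrite E ?rot_up_cell ?rot_down_cell subrK.
move: (tD) (tD); case: t tD => [[a b] c] tD tD1; rewrite inE => H.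
have [ab|nab] := boolP (a < n <= b); first exact: base.
have [bc|nbc] := boolP (b < n <= c).
  by apply: (back); apply: base => //; rewrite Hregion_rot.
apply: (back); apply: (back); apply: base; first by rewrite !Hregion_rot.
by move: H nab nbc; rewrite /=; lia.
Qed.

Lemma share_edge_cells z k z' k' :
  share_edge (up_cell z k) (down_cell z' k') = grid_edge z z' (k' - k)%R.
Proof.
rewrite /grid_edge.
have E (i : nat) m m' : share_edge (up_cell z m) (down_cell z' m') =
    share_edge (up_cell z (m + inord 1 *+ i))%R (down_cell z' (m' + inord 1 *+ i))%R.
  elim: i => [|i ->]; first by rewrite mulr0n !addr0.
  by rewrite !mulrSr !addrA -rot_up_cell -rot_down_cell share_edge_rot.
have [i Ei] : exists i, (- k = inord 1 *+ i :> 'I_3)%R.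
  move: k; apply: ord3P; [exists 0%N|exists 2%N|exists 1%N]; apply: val_inj;
    by rewrite /= ?inordK // ?val_Zp_mulrn.
by rewrite (E i) -Ei subrr; congr share_edge; congr up_cell; apply: val_inj.
Qed.

Lemma grid_edgeP z z' : [exists k, grid_edge z z' k] = grid_step z z'.
Proof.
have := ltn_ord z.2; have := ltn_ord z.1.
have := ltn_ord z'.2; have := ltn_ord z'.1.
rewrite /grid_edge /grid_step; case: z z' => [i j] [i' j'] /= ? ? ? ?.
apply/existsP/idP => [[]|].
  apply: ord3P; rewrite /down_cell ?inordK //= -!val_eqE /=;
    case/or3P => /and3P[/eqP ? /eqP ? /eqP ?]; try by [exfalso; lia];
    apply/or4P.
  - by apply: Or42; apply/andP; split; apply/eqP; lia.
  - by apply: Or43; apply/andP; split; apply/eqP; lia.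
  - by apply: Or41; apply/andP; split; apply/eqP; lia.
  - by apply: Or44; apply/and3P; split; apply/eqP; lia.
case/or4P => [/andP[/eqP ? /eqP ?]|/andP[/eqP ? /eqP ?]|/andP[/eqP ? /eqP ?]
    |/and3P[/eqP ? /eqP ? /eqP ?]];
  [exists (inord 0)|exists (inord 0)|exists (inord 0)|exists (inord 2)];
  rewrite /down_cell ?inordK //= -!val_eqE /=; apply/or3P.
- by apply: Or33; apply/and3P; split; apply/eqP; lia.
- by apply: Or31; apply/and3P; split; apply/eqP; lia.
- by apply: Or32; apply/and3P; split; apply/eqP; lia.
- by apply: Or32; apply/and3P; split; apply/eqP; lia.
Qed.

(** Only a wrap raises the column, from 0 to n + x - 1 - i >= x > 0, so comparing columns reveals
    the rotation. *)
Lemma grid_edge_turn z z' k :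
  grid_edge z z' k -> k = if z.2 < z'.2 then inord 2 else inord 0.
Proof.
have := ltn_ord z.2; have := ltn_ord z.1.
have := ltn_ord z'.2; have := ltn_ord z'.1.
rewrite /grid_edge; case: z z' => [i j] [i' j'] /= ? ? ? ?.
by move: k; apply: ord3P; rewrite /down_cell ?inordK //= -!val_eqE /=;
  case/or3P => /and3P[/eqP ? /eqP ? /eqP ?]; case: ltnP => // ?; exfalso; lia.
Qed.

Lemma grid_edge_inj z z' k k' : grid_edge z z' k -> grid_edge z z' k' -> k = k'.
Proof. by move=> /grid_edge_turn-> /grid_edge_turn->. Qed.

Lemma lozenge_cells (L : {set cell N}) : L \subset Hregion n x -> lozenge L ->
  exists z k z' k', grid_edge z z' (k' - k)%R /\ L = [set up_cell z k; down_cell z' k'].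
Proof.
move=> LD /existsP[u /existsP[d /and4P[uu dd ud /eqP EL]]]; move: LD.
rewrite EL subUset !sub1set => /andP[uD dD].
case: (region_cover uD) => -[z [k Eu]]; last first.
  by move: uu (down_cell_down z k); rewrite -Eu; case: (u) => [[a b] c] /=; lia.
case: (region_cover dD) => -[z' [k' Ed]].
  by move: dd (up_cell_up z' k'); rewrite -Ed; case: (d) => [[a b] c] /=; lia.
by exists z, k, z', k'; rewrite -share_edge_cells -Eu -Ed.
Qed.

Lemma cells_lozenge z k z' k' :
  grid_edge z z' (k' - k)%R -> lozenge [set up_cell z k; down_cell z' k'].
Proof.
move=> H; apply/existsP; exists (up_cell z k); apply/existsP; exists (down_cell z' k').
by rewrite up_cell_up down_cell_down share_edge_cells H eqxx.
Qed.

End HexagonCells.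


(** The grid is numbered through [enum_val] so that these permutations can index the expansion of a
    determinant. *)
Lemma CS_card_perm (n x : nat) : 0 < x ->
  CS n x = #|[set s : {perm 'I_#|{: 'I_n * 'I_(n + x)}|} |
     [forall z, grid_step (enum_val z) (enum_val (s z))]]|.
Proof.
move=> x_gt0.
have r_gen (k : 'I_3) : exists i, (k = inord 1 *+ i)%R.
  move: k; apply: ord3P; [exists 0%N|exists 1%N|exists 2%N]; apply: val_inj;
    by rewrite /= ?inordK // ?val_Zp_mulrn.
rewrite -(eq_card (A := [set s | perm_edge
    (fun u v => grid_edge (enum_val u) (enum_val v)) s])); last first.
  move=> s; rewrite !inE; apply: eq_forallb => z; exact: grid_edgeP.
rewrite -(card_sym_tilings (r := inord 1) (D := Hregion n x) (rot := @rot120 _)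
  (loz := @lozenge _) (cu := fun u => up_cell (enum_val u))
  (cd := fun u => down_cell (enum_val u))) //.
- by move=> z k; rewrite rot_up_cell.
- by move=> z k; rewrite rot_down_cell.
- by move=> z k z' k' /(up_cell_inj x_gt0)[/enum_val_inj].
- by move=> z k z' k' /(down_cell_inj x_gt0)[/enum_val_inj].
- by move=> z k z' k'; apply: up_down_cell.
- by move=> z k; apply: up_cell_region.
- by move=> z k; apply: down_cell_region.
- move=> t /(region_cover x_gt0)[] [z [k ->]]; [left|right];
  by exists (enum_rank z), k; rewrite enum_rankK.
- move=> L LD /(lozenge_cells x_gt0 LD)[z [k [z' [k' [H ->]]]]].
  by exists (enum_rank z), k, (enum_rank z'), k'; rewrite !enum_rankK.
- by move=> z k z' k' H; apply: cells_lozenge.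
- by move=> z z' k k'; apply: grid_edge_inj.
Qed.

(** * Signs of the grid permutations *)

Section CycleSigns.

Variables (T : finType) (r c : T -> nat) (n w : nat) (s : {perm T}).
Hypothesis n_lt_w : n < w.
Hypothesis r_lt : forall z, r z < n.
Hypothesis rc_inj : forall y z, r y = r z -> c y = c z -> y = z.

(** Here [r] and [c] stand for the row and column of a cell, and [w] for the number n + x of
    columns. *)
Definition wraps (z : T) : bool :=
  [&& c z == 0, (r (s z)).+1 == n & (r z + c (s z)).+1 == w].

Hypothesis s_step : forall z,
  [|| s z == z, (r z == (r (s z)).+1) && (c z == c (s z)),
      (r z == r (s z)) && (c z == (c (s z)).+1) | wraps z].

Lemma iter_fix i z : s (iter i s z) = iter i s z -> s z = z.
Proof. by rewrite -iterS iterSr; elim: i => //= i IH /perm_inj. Qed.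

Lemma wraps_move z : wraps z -> s z <> z.
Proof. by move=> /and3P[/eqP c0 /eqP rn /eqP rw] E; rewrite E in rn rw; lia. Qed.

Lemma step_down z : s z <> z -> ~~ wraps z ->
  [/\ r z + c z = (r (s z) + c (s z)).+1, r (s z) <= r z & r z <= (r (s z)).+1].
Proof.
move=> /eqP/negbTE nfix /negbTE nw; have := s_step z; rewrite nfix nw /= orbF.
by move=> H; split; lia.
Qed.

(** The return time is [t.+1], which excludes the wrap at [z] itself. *)
Definition first_return z t :=
  wraps (iter t.+1 s z) /\ (forall i, i < t -> ~~ wraps (iter i.+1 s z)).

Lemma first_return_exists z : wraps z -> exists t, first_return z t.
Proof.
move=> wz.
have ex : exists t, wraps (iter t.+1 s z).
  exists #|porbit s z|.-1; rewrite prednK ?iter_porbit //.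
  by apply/card_gt0P; exists z; exact: porbit_id.
exists (ex_minn ex); case: ex_minnP => t wt tmin; split=> // i it.
by apply/negP => /tmin; rewrite leqNgt it.
Qed.

(** The wrap at [z] enters the antidiagonal r + c = n + w - 2 - r z, and each later step lowers r +
    c by 1. *)
Lemma return_level z t i : wraps z -> first_return z t -> i <= t ->
  [/\ r (iter i.+1 s z) + c (iter i.+1 s z) + i + r z = n + w - 2 & r (iter i.+1 s z) < n].
Proof.
move=> wz [_ nwt] it; split; last exact: r_lt.
elim: i it => [|i IH] it.
  by move: (wz) => /and3P[_ /eqP ? /eqP ?] /=; lia.
have nfix : s (iter i.+1 s z) <> iter i.+1 s z by move/iter_fix; exact: wraps_move.
have [H _ _] := step_down nfix (nwt _ it).
by have := IH (ltnW it); rewrite H -iterS; lia.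
Qed.

Lemma return_row_le z t i j : wraps z -> first_return z t -> i <= j <= t ->
  r (iter j.+1 s z) <= r (iter i.+1 s z).
Proof.
move=> wz [_ nwt] /andP[/subnKC <-]; elim: (j - i) => [|d IH] dt; first by rewrite addn0.
have nfix : s (iter (i + d).+1 s z) <> iter (i + d).+1 s z.
  by move/iter_fix; exact: wraps_move.
rewrite addnS in dt *; have [_ H _] := step_down nfix (nwt _ dt).
by apply: leq_trans (IH (ltnW dt)); rewrite iterS.
Qed.

(* Two return paths on the same antidiagonal occupy distinct cells, hence keep
   their order: this is where planarity enters. *)
Lemma return_mono z1 z2 t1 t2 : wraps z1 -> wraps z2 ->
  first_return z1 t1 -> first_return z2 t2 -> r z1 < r z2 ->
  r (iter t1.+1 s z1) < r (iter t2.+1 s z2).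
Proof.
move=> w1 w2 f1 f2 r12.
(* The path from [z1] starts d antidiagonals above the one from [z2]; delaying the comparison by d
   steps puts both on the same antidiagonal. *)
have [d dE] : exists d, d + r z1 = r z2 by exists (r z2 - r z1); lia.
have d_gt0 : 0 < d by lia.
have [wt1 nwt1] := f1; have [wt2 nwt2] := f2.
have r2n := r_lt z2.
have dt1 : d <= t1.
  have [] := return_level w1 f1 (leqnn _); have /and3P[/eqP-> _ _] := wt1.
  by lia.
(* A meeting would make [z2] the d-th iterate of [z1], that is, a wrap before the first return of
   [z1]. *)
have dist i : i <= t2 -> i + d <= t1 -> iter (i + d).+1 s z1 <> iter i.+1 s z2.
  move=> it2 it1 E; have : iter d s z1 = z2.
    by move: E; rewrite -addSn iterD; elim: (i.+1) => //= k IH /perm_inj.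
  move=> Ez; have := nwt1 d.-1; rewrite prednK // Ez w2.
  by move=> /(_ (leq_trans (leq_addl i d) it1)).
(* A step changes the row by 0 or -1, so a strict inequality of rows can degrade at most to an
   equality, which [dist] excludes. *)
have key i : i <= t2 -> i + d <= t1 -> r (iter (i + d).+1 s z1) < r (iter i.+1 s z2).
  elim: i => [|i IH] it2 it1.
    have [H1 H2] := return_level w1 f1 it1; have [H3 _] := return_level w2 f2 it2.
    have D := dist 0 it2 it1; rewrite ltn_neqAle; apply/andP; split.
      apply/eqP => E; apply: D; apply: rc_inj => //.
      by move: (iter _ s z1) (iter _ s z2) H1 H3 E => a b; lia.
    by have /and3P[_ /eqP E _] := w2; rewrite -ltnS /= E.
  have [H1 _] := return_level w1 f1 it1; have [H3 _] := return_level w2 f2 it2.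
  have D := dist _ it2 it1.
  have {}IH := IH (ltnW it2) (ltnW it1).
  have nfix1 : s (iter (i + d).+1 s z1) <> iter (i + d).+1 s z1.
    by move/iter_fix; exact: wraps_move.
  have nfix2 : s (iter i.+1 s z2) <> iter i.+1 s z2.
    by move/iter_fix; exact: wraps_move.
  have [_ A1 _] := step_down nfix1 (nwt1 _ it1).
  have [_ _ A2] := step_down nfix2 (nwt2 _ it2).
  have {}A1 : r (iter (i.+1 + d).+1 s z1) <= r (iter (i + d).+1 s z1) by [].
  have {}A2 : r (iter i.+1 s z2) <= (r (iter i.+2 s z2)).+1 by [].
  rewrite ltn_neqAle; apply/andP; split; last first.
    by apply: leq_trans A1 _; rewrite -ltnS; apply: leq_trans IH A2.
  apply/eqP => E; apply: D; apply: rc_inj => //.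
  by move: (iter _ s z1) (iter _ s z2) H1 H3 E => a b; lia.
case: (leqP (t2 + d) t1) => H.
  apply: leq_ltn_trans (key _ (leqnn _) H).
  by apply: (return_row_le w1 f1); rewrite H leqnn.
(* Otherwise the first path ends before the second, in column 0; that is the largest row of its
   antidiagonal, so the second path cannot lie in a larger one. *)
have it2 : t1 - d <= t2 by lia.
have it1 : t1 - d + d <= t1 by lia.
have K := key _ it2 it1; rewrite subnK // in K it1.
have [H1 _] := return_level w1 f1 it1; have [H3 _] := return_level w2 f2 it2.
by move: H1 H3; have /and3P[/eqP-> _ _] := wt1; lia.
Qed.

(** The first return is a strictly increasing self-map of the finitely many wrapping cells, ordered
    by row, hence the identity. The inductions [lo] and [hi] exclude a decrease and an increase of
    the row. *)
Lemma return_id z t : wraps z -> first_return z t -> iter t.+1 s z = z.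
Proof.
have lo k : forall z t, r z <= k -> wraps z -> first_return z t -> r z <= r (iter t.+1 s z).
  elim: k => [|k IH] {}z {}t rk wz fz; first by lia.
  rewrite leqNgt; apply/negP => lt.
  have [we _] := fz; have [t' fe] := first_return_exists we.
  have := return_mono we wz fe fz lt; rewrite ltnNge => /negP; apply.
  by apply: IH => //; lia.
have hi k : forall z t, n <= r z + k -> wraps z -> first_return z t -> r (iter t.+1 s z) <= r z.
  elim: k => [|k IH] {}z {}t rk wz fz; first by have := r_lt z; lia.
  rewrite leqNgt; apply/negP => lt.
  have [we _] := fz; have [t' fe] := first_return_exists we.
  have := return_mono wz we fz fe lt; rewrite ltnNge => /negP; apply.
  by apply: IH => //; lia.
move=> wz fz; apply: rc_inj.
  apply/eqP; rewrite eqn_leq (lo (r z)) // (hi n) //.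
  by rewrite leq_addl.
by have [/and3P[/eqP-> _ _] _] := fz; have /and3P[/eqP-> _ _] := wz.
Qed.

Lemma wraps_porbit_inj y z : wraps y -> wraps z -> y \in porbit s z -> y = z.
Proof.
move=> wy wz /porbitP[i Ey]; rewrite permX in Ey.
have [t fz] := first_return_exists wz; have E := return_id wz fz.
have Em m : iter (m * t.+1) s z = z.
  by elim: m => // m IH; rewrite mulSn iterD IH.
move: Ey; rewrite (divn_eq i t.+1) addnC iterD Em.
have := ltn_pmod i (ltn0Sn t); case: (i %% t.+1) => [//|j] jt Ey.
by have [_ /(_ j jt)] := fz; rewrite -Ey wy.
Qed.

(** A cell minimizing r + c on its cycle must wrap, since every other nontrivial step lowers r +
    c. *)
Lemma porbit_wraps z : s z != z -> exists2 y, y \in porbit s z & wraps y.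
Proof.
move=> nfix; case: (arg_minnP (fun y => r y + c y) (porbit_id s z)) => y yz ymin.
have {}yz : y \in porbit s z := yz.
exists y => //; apply/negPn/negP => nw.
have nfy : s y <> y.
  move/eqP: nfix => nfix; move=> fy; case: nfix.
  have := yz; rewrite porbit_sym => /porbitP[i ->]; rewrite permX.
  by elim: i => //= i IH; rewrite IH IH.
have [H _ _] := step_down nfy nw.
have sy : s y \in porbit s z.
  move: yz; rewrite -eq_porbit_mem => /eqP <-.
  by have := mem_porbit s 1 y; rewrite expg1.
by have := ymin _ sy; rewrite H ltnn.
Qed.

(** Each cycle contains exactly one counted cell: its fixed point if trivial, its unique wrap
    otherwise. *)
Lemma card_porbits_wraps : #|porbits s| = #|[set z | (s z == z) || wraps z]|.
Proof.
rewrite -(card_in_imset (f := porbit s)) => [|y z]; last first.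
  rewrite !inE => Hy Hz E.
  have yz : y \in porbit s z by rewrite -E porbit_id.
  have zy : z \in porbit s y by rewrite E porbit_id.
  have fixE u v : s u == u -> v \in porbit s u -> v = u.
    by move=> /eqP fu /porbitP[i ->]; rewrite permX; elim: i => //= i ->.
  case/orP: Hy => Hy; first by rewrite (fixE _ _ Hy zy).
  case/orP: Hz => Hz; first by rewrite (fixE _ _ Hz yz).
  exact: wraps_porbit_inj.
apply: eq_card => O; apply/imsetP/imsetP => -[z zP ->]; last by exists z.
have [fz|nfz] := boolP (s z == z); first by exists z; rewrite ?inE ?fz.
have [y yz wy] := porbit_wraps nfz; exists y; rewrite ?inE ?wy ?orbT //.
by apply/esym/eqP; rewrite eq_porbit_mem.
Qed.

(** The sign of [s] has exponent cells minus cycles. Cycles are as many as the cells of weight 1, so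
    this exponent has the parity of the number of cells of weight -1. *)
Lemma sign_wraps (R : pzRingType) :
  ((-1) ^+ s * \prod_z (if (s z == z) || wraps z then 1 else -1) = 1 :> R)%R.
Proof.
rewrite (eq_bigr (fun z => if ~~ ((s z == z) || wraps z) then -1 else 1)%R); last first.
  by move=> z _; case: ifP.
rewrite -big_mkcond /= prodr_const -exprD -signr_odd oddD.
rewrite /odd_perm card_porbits_wraps oddb -(cardsC [set z | (s z == z) || wraps z]).
rewrite oddD; have -> : #|~: [set z | (s z == z) || wraps z]| =
    #|[pred z | ~~ ((s z == z) || wraps z)]|.
  by apply: eq_card => z; rewrite !inE.
by case: (odd _); case: (odd _).
Qed.


End CycleSigns.

(** * Reduction to the determinant of [1 + B] *)

Local Open Scope ring_scope.

(** Sylvester's identity, from two triangular factorizations of the block matrix with rows (1, -A)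
    and (B, 1). *)
Lemma det_1D_mulmxC (R : comNzRingType) m n (A : 'M[R]_(m, n)) (B : 'M[R]_(n, m)) :
  \det (1%:M + A *m B) = \det (1%:M + B *m A).
Proof.
have E1 : block_mx 1%:M (- A) B 1%:M =
    block_mx 1%:M 0 B 1%:M *m block_mx 1%:M (- A) 0 (1%:M + B *m A).
  by rewrite mulmx_block !mul1mx !mul0mx !mulmx1 !addr0 mulmxN addrCA addNr addr0.
have E2 : block_mx 1%:M (- A) B 1%:M =
    block_mx (1%:M + A *m B) (- A) 0 1%:M *m block_mx 1%:M 0 B 1%:M.
  by rewrite mulmx_block !mul1mx !mul0mx !mulmx1 !mulmx0 !add0r mulNmx addrK.
have := congr1 determinant E1; rewrite {1}E2 !det_mulmx !det_ublock !det_lblock.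
by rewrite !det1 !mulr1 !mul1r.
Qed.

Lemma det_mxsub_inj (R : comPzRingType) n (h : 'I_n -> 'I_n) (A : 'M[R]_n) :
  injective h -> \det (mxsub h h A) = \det A.
Proof.
move=> h_inj; have -> : mxsub h h A = row_perm (perm h_inj) (col_perm (perm h_inj) A).
  by apply/matrixP => i j; rewrite !mxE !permE.
rewrite row_permE col_permE !det_mulmx !det_perm odd_permV.
by rewrite mulrC -mulrA -signr_addb addbb mulr1.
Qed.

(** * The determinant of the grid and its evaluation by lattice paths *)

Section GridDeterminant.

Variables (R : comNzRingType) (n x : nat).
Hypothesis x_gt0 : (0 < x)%N.

Notation grid := ('I_n * 'I_(n + x))%type.
Notation m := #|{: grid}|.

Definition row_of (z : 'I_m) : nat := (enum_val z).1.
Definition col_of (z : 'I_m) : nat := (enum_val z).2.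

Lemma row_of_lt z : (row_of z < n)%N. Proof. exact: ltn_ord. Qed.

Lemma col_of_lt z : (col_of z < n + x)%N. Proof. exact: ltn_ord. Qed.

Definition grid_down (z z' : 'I_m) : bool :=
  ((row_of z == (row_of z').+1) && (col_of z == col_of z')) ||
  ((row_of z == row_of z') && (col_of z == (col_of z').+1)).

Definition grid_wrap (z z' : 'I_m) : bool :=
  [&& col_of z == 0, (row_of z').+1 == n & (row_of z + col_of z').+1 == n + x]%N.

Lemma grid_eqP (z z' : 'I_m) : row_of z = row_of z' -> col_of z = col_of z' -> z = z'.
Proof.
rewrite /row_of /col_of => rE cE; apply: enum_val_inj; move: rE cE.
by case: (enum_val z) (enum_val z') => [a b] [a' b'] /= /val_inj-> /val_inj->.
Qed.

Lemma grid_stepE (z z' : 'I_m) :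
  grid_step (enum_val z) (enum_val z') = [|| z == z', grid_down z z' | grid_wrap z z'].
Proof.
have -> : (z == z') = (row_of z == row_of z') && (col_of z == col_of z').
  by apply/eqP/andP => [->//|[/eqP ? /eqP ?]]; apply: grid_eqP.
have := col_of_lt z'; have := row_of_lt z.
rewrite /grid_step /grid_down /grid_wrap -!/(row_of _) -!/(col_of _) => h1 h2.
lia.
Qed.

Lemma grid_down_irr z : grid_down z z = false.
Proof. by rewrite /grid_down; lia. Qed.

Lemma grid_wrap_irr z : grid_wrap z z = false.
Proof. by apply/negP => /and3P[/eqP c0 /eqP rn /eqP]; rewrite c0 addn0 rn; lia. Qed.

Lemma grid_down_wrap z z' : grid_down z z' -> grid_wrap z z' = false.
Proof.
move=> dz; apply/negP => /and3P[/eqP c0 /eqP rn _]; have rz := row_of_lt z.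
by case/orP: dz => /andP[/eqP rE /eqP cE]; lia.
Qed.

Definition down_mx : 'M[R]_m := \matrix_(z, z') ((z == z')%:R - (grid_down z z')%:R).
(** The wraps form a matrix of rank at most n. It factors over the row i of departure: [exit_mx]
    marks (i, 0) and [entry_mx] marks (n - 1, n + x - 1 - i). *)
Definition exit_mx : 'M[R]_(m, n) :=
  \matrix_(z, i) ((row_of z == i) && (col_of z == 0%N))%:R.
Definition entry_mx : 'M[R]_(n, m) :=
  \matrix_(i, z) ((row_of z == n.-1) && (col_of z == (n + x).-1 - i)%N)%:R.

Definition step_mx : 'M[R]_m :=
  \matrix_(z, z') ((z == z')%:R - (grid_down z z')%:R + (grid_wrap z z')%:R).

Lemma step_mxE : step_mx = down_mx + exit_mx *m entry_mx.
Proof.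
apply/matrixP => z z'; rewrite !mxE; congr (_ + _).
rewrite (bigD1 (enum_val z).1) //= !mxE eqxx /= big1 ?addr0 => [|i ni].
  rewrite -natrM mulnb; congr ((nat_of_bool _)%:R); rewrite /grid_wrap -/(row_of z).
  by have := row_of_lt z; have := col_of_lt z'; lia.
have nz : (row_of z == i) = false by rewrite eq_sym; exact: negbTE.
by rewrite !mxE nz mul0r.
Qed.

(** In the Leibniz expansion a forbidden move gives a zero factor, and every remaining permutation
    contributes exactly 1 by [sign_wraps]. *)
Lemma card_grid_perm :
  #|[set s : {perm 'I_m} | [forall z, grid_step (enum_val z) (enum_val (s z))]]|%:R
  = \det step_mx.
Proof.
rewrite -sum1_card natr_sum big_mkcond /=; apply: eq_bigr => s _; rewrite inE.
case: ifPn => [/forallP vs|/forallPn[z]]; last first.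
  rewrite grid_stepE => /norP[/negbTE n1 /norP[/negbTE n2 /negbTE n3]].
  by rewrite (bigD1 z) //= mxE n1 n2 n3 subrr addr0 mul0r mulr0.
have st z : [|| s z == z,
   (row_of z == (row_of (s z)).+1) && (col_of z == col_of (s z)),
   (row_of z == row_of (s z)) && (col_of z == (col_of (s z)).+1)
   | wraps row_of col_of n (n + x) s z].
  have := vs z; rewrite grid_stepE /grid_down /grid_wrap /wraps.
  by rewrite [z == _]eq_sym !orbA.
have nx : (n < n + x)%N by rewrite -{1}[n]addn0 ltn_add2l.
rewrite mulr1n -[LHS](sign_wraps nx row_of_lt grid_eqP st R).
congr (_ * _); apply: eq_bigr => z _; rewrite mxE.
have wE : wraps row_of col_of n (n + x) s z = grid_wrap z (s z) by [].
rewrite wE [s z == z]eq_sym.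
have := vs z; rewrite grid_stepE; case: eqP => [<- _|_ /=].
  by rewrite grid_down_irr grid_wrap_irr subr0 addr0.
case/orP => [dz|wz]; first by rewrite dz grid_down_wrap // sub0r addr0.
have nd : grid_down z (s z) = false by apply/negbTE/negP => /grid_down_wrap; rewrite wz.
by rewrite wz nd subrr add0r.
Qed.

Lemma det_down_mx : \det down_mx = 1.
Proof.
rewrite /determinant (bigD1 1%g) //= odd_perm1 mul1r big1 => [|z _]; last first.
  by rewrite !mxE perm1 eqxx grid_down_irr subr0.
rewrite big1 ?addr0 // => s ns.
have [/forallP vs|/forallPn[z]] := boolP [forall z, (z == s z) || grid_down z (s z)]; last first.
  rewrite negb_or => /andP[/negbTE n1 /negbTE n2].
  by rewrite (bigD1 z) //= mxE n1 n2 subrr mul0r mulr0.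
case/eqP: ns; apply/permP => z; rewrite perm1.
pose lev z := (row_of z + col_of z)%N.
have le z0 : (lev (s z0) <= lev z0 ?= iff (z0 == s z0))%N.
  apply/leqifP; have := vs z0; case: eqP => [<- //|_] /=; rewrite /grid_down /lev.
  by lia.
have /leqif_sum[_] := fun z0 (_ : true) => le z0.
rewrite [\sum_i lev i](reindex_inj (@perm_inj _ s)) eqxx => /esym/forallP/(_ z).
by rewrite /= => /eqP <-.
Qed.

(* Lattice paths from (r, c) to (i, 0) whose steps decrease one coordinate by 1. *)
Definition npaths (i r c : nat) : nat := if (i <= r)%N then 'C(r - i + c, c) else 0.

Lemma npaths_rec i r c : npaths i r c =
  ((if 0 < r then npaths i r.-1 c else 0) + (if 0 < c then npaths i r c.-1 else 0)
   + ((r == i) && (c == 0)))%N.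
Proof.
rewrite /npaths; case: c => [|c]; rewrite /= ?bin0 ?andbT ?andbF ?addn0.
  by do ![case: ifP => ?]; lia.
case: (leqP i r) => ir; last first.
  by do ![case: ifP => ?]; lia.
case: (r =P i) => [->|ri].
  by rewrite subnn !binn; do ![case: ifP => ?]; lia.
have -> : (0 < r)%N by lia.
have -> : (i <= r.-1)%N by lia.
have -> : (r - i + c.+1 = (r.-1 - i + c.+1).+1)%N by lia.
by rewrite binS; congr (_ + 'C(_, _))%N; lia.
Qed.

Definition paths_mx : 'M[R]_(m, n) :=
  \matrix_(z, i) (npaths i (row_of z) (col_of z))%:R.

Lemma sum_grid_at (a b : nat) (F : nat -> nat -> R) :
  \sum_(z < m) ((row_of z == a) && (col_of z == b))%:R * F (row_of z) (col_of z) =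
  if ((a < n) && (b < n + x))%N then F a b else 0.
Proof.
rewrite (reindex (@enum_rank _)) /=; last exact/onW_bij/enum_rank_bij.
under eq_bigr do rewrite /row_of /col_of enum_rankK.
case: ifPn => [/andP[an bn]|nab].
  rewrite (bigD1 (Ordinal an, Ordinal bn)) //= !eqxx mul1r.
  rewrite big1 ?addr0 // => -[i j] nij /=.
  case: eqP => [ia|_]; last by rewrite mul0r.
  case: eqP => [jb|_]; last by rewrite mul0r.
  by case/eqP: nij; congr (_, _); apply: val_inj.
apply: big1 => -[i j] _ /=.
case: eqP => [ia|_]; last by rewrite mul0r.
case: eqP => [jb|_]; last by rewrite mul0r.
by case/negP: nab; rewrite -ia -jb !ltn_ord.
Qed.

(** Decomposing a path by its first step shows that [paths_mx] is the inverse of [down_mx] applied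
    to [exit_mx]. *)
Lemma down_paths : down_mx *m paths_mx = exit_mx.
Proof.
apply/matrixP => z i; rewrite !mxE.
have rz := row_of_lt z; have cz := col_of_lt z.
pose F r c : R := (npaths i r c)%:R.
transitivity (F (row_of z) (col_of z)
  - ((if (0 < row_of z)%N then F (row_of z).-1 (col_of z) else 0)
     + (if (0 < col_of z)%N then F (row_of z) (col_of z).-1 else 0))).
  under eq_bigr do rewrite !mxE mulrBl.
  rewrite sumrB (bigD1 z) //= eqxx mul1r big1 ?addr0 => [|z' nz]; last first.
    by rewrite eq_sym (negbTE nz) mul0r.
  congr (_ - _).
  have S1 := sum_grid_at (row_of z).-1 (col_of z) F.
  have S2 := sum_grid_at (row_of z) (col_of z).-1 F.
  have -> : (if (0 < row_of z)%N then F (row_of z).-1 (col_of z) else 0) =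
      \sum_(z' < m) ((row_of z == (row_of z').+1) && (col_of z == col_of z'))%:R
         * F (row_of z') (col_of z').
    case: ifPn => r0; last first.
      by rewrite big1 // => z' _; rewrite (_ : _ && _ = false) ?mul0r //; lia.
    rewrite (_ : F _ _ = if ((row_of z).-1 < n)%N && (col_of z < n + x)%N
       then F (row_of z).-1 (col_of z) else 0); last by rewrite ifT //; lia.
    rewrite -S1; apply: eq_bigr => z' _; congr ((nat_of_bool _)%:R * _); lia.
  have -> : (if (0 < col_of z)%N then F (row_of z) (col_of z).-1 else 0) =
      \sum_(z' < m) ((row_of z == row_of z') && (col_of z == (col_of z').+1))%:R
         * F (row_of z') (col_of z').
    case: ifPn => r0; last first.
      by rewrite big1 // => z' _; rewrite (_ : _ && _ = false) ?mul0r //; lia.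
    rewrite (_ : F _ _ = if (row_of z < n)%N && ((col_of z).-1 < n + x)%N
       then F (row_of z) (col_of z).-1 else 0); last by rewrite ifT //; lia.
    rewrite -S2; apply: eq_bigr => z' _; congr ((nat_of_bool _)%:R * _); lia.
  rewrite -big_split /=; apply: eq_bigr => z' _; rewrite -mulrDl -natrD.
  congr (_%:R * _); rewrite /grid_down; lia.
rewrite /F npaths_rec !natrD; case: ifP => _; case: ifP => _; rewrite ?mulr0n; ring.
Qed.

Lemma det_step_mx :
  \det step_mx = \det (1%:M + \matrix_(i < n, j < n) 'C(x + i + j, j)%:R).
Proof.
have -> : step_mx = down_mx *m (1%:M + paths_mx *m entry_mx).
  by rewrite mulmxDr mulmx1 mulmxA down_paths step_mxE.
rewrite det_mulmx det_down_mx mul1r det_1D_mulmxC.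
(* The entries now count paths from (n - 1, n + x - 1 - i) to (j, 0); reversing both indices turns
   them into C(x + i + j, j). *)
rewrite -(det_mxsub_inj _ (@rev_ord_inj n)); congr (\det _).
apply/matrixP => i j; rewrite !mxE (inj_eq (@rev_ord_inj n)); congr (_ + _).
under eq_bigr do rewrite !mxE.
rewrite (sum_grid_at _ _ (fun r c => (npaths (rev_ord j) r c)%:R)).
have iN := ltn_ord i; have jN := ltn_ord j.
rewrite ifT; last by rewrite /=; lia.
rewrite /npaths ifT /=; last by lia.
rewrite -bin_sub; last by lia.
by congr ('C(_, _)%:R); lia.
Qed.

End GridDeterminant.

Theorem CS_det (R : comNzRingType) (n x : nat) : (0 < x)%N ->
  (CS n x)%:R = \det (1%:M + \matrix_(i < n, j < n) 'C(x + i + j, j)%:R) :> R.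
Proof. by move=> x_gt0; rewrite CS_card_perm // card_grid_perm // det_step_mx. Qed.

(** * Splitting the determinant by parity *)

Local Notation symP := ('X * ('X + 1) : {poly rat}).
Local Notation symQ := ('X *+ 2 + 1 : {poly rat}).

Section Coefficients.

Implicit Types (n i j k : nat) (z : int).

(* The value 0 at negative integers makes [ifact_pred] hold without exception. *)
Definition ifact z : rat := if z is Posz k then (k`!%:R)^-1 else 0.

Lemma ifact_nat k : ifact k%:Z = (k`!%:R)^-1.
Proof. by []. Qed.

Lemma ifact_pred z : ifact (z - 1) = z%:~R * ifact z.
Proof.
case: z => [[|k]|k] //.
- rewrite (_ : k.+1%:Z - 1 = k%:Z); last by lia.
  by rewrite /= factS natrM invfM mulrA divff ?mul1r // pnatr_eq0.
- by rewrite mulr0 (_ : Negz k - 1 = Negz k.+1) //; lia.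
Qed.

Lemma coef_X1n n i : (('X + 1) ^+ n : {poly rat})`_i = 'C(n, i)%:R.
Proof.
rewrite exprD1n coef_sum; under eq_bigr do rewrite coefMn coefXn.
have [ni|ni] := ltnP i n.+1.
  rewrite (bigD1 (Ordinal ni)) //= eqxx big1 ?addr0 // => j nj.
  by rewrite [i == _]eq_sym; move/negbTE: nj; rewrite -val_eqE /= => ->; rewrite mul0rn.
rewrite bin_small // big1 // => j _.
by rewrite gtn_eqF ?mul0rn // (leq_trans (ltn_ord j)).
Qed.

Lemma bin_ifact n k : ('C(n, k)%:R : rat) = n`!%:R * ifact k%:Z * ifact (n%:Z - k%:Z).
Proof.
have [kn|nk] := leqP k n.
  rewrite subzn // !ifact_nat -(bin_fact kn) natrM natrM -mulrA -invfM mulfK //.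
  by rewrite mulf_neq0 // pnatr_eq0 -lt0n fact_gt0.
rewrite bin_small // (_ : n%:Z - k%:Z = Negz (k - n).-1) ?mulr0 // NegzE; lia.
Qed.

Lemma coef_XnX1n d n i : ('X^d * ('X + 1) ^+ n : {poly rat})`_i =
  n`!%:R * ifact (i%:Z - d%:Z) * ifact (n%:Z - (i%:Z - d%:Z)).
Proof.
rewrite coefXnM; case: ltnP => [id|di]; last by rewrite coef_X1n bin_ifact -subzn.
by rewrite (_ : i%:Z - d%:Z = Negz (d - i).-1) ?mulr0 ?mul0r // NegzE; lia.
Qed.

(** Both sides are the coefficient of t^i in p(-1 - t); summands beyond the size of p vanish. *)
Lemma reflect_coef (p : {poly rat}) (eps : rat) (N i : nat) :
  p \Po (- ('X + 1)) = eps *: p -> (size p <= N)%N ->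
  \sum_(j < N) p`_j * (-1) ^+ j * 'C(j, i)%:R = eps * p`_i.
Proof.
move=> pr sN; rewrite -coefZ -pr coef_comp_poly.
rewrite (big_ord_widen N (fun j => p`_j * ((- ('X + 1)) ^+ j)`_i)) //.
rewrite [RHS]big_mkcond /=; apply: eq_bigr => j _.
case: ltnP => [_|pj]; last by rewrite nth_default // !mul0r.
have eN : (-1) ^+ j = ((-1) ^+ j)%:P :> {poly rat} by rewrite polyC_exp polyCN.
by rewrite [(- ('X + 1)) ^+ j]exprNn eN coefCM coef_X1n mulrA.
Qed.

Lemma symP_reflect k : (symP ^+ k) \Po (- ('X + 1)) = symP ^+ k.
Proof.
rewrite rmorphXn /= rmorphM rmorphD /= comp_polyX rmorph1; congr (_ ^+ _).
by ring.
Qed.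

Lemma symQP_reflect k : (symQ * symP ^+ k) \Po (- ('X + 1)) = - (symQ * symP ^+ k).
Proof.
rewrite rmorphM /= symP_reflect -mulNr; congr (_ * _).
by rewrite rmorphD rmorphMn /= comp_polyX rmorph1; ring.
Qed.

Lemma coef_symP k i : (symP ^+ k)`_i = if (i < k)%N then 0 else 'C(k, i - k)%:R.
Proof. by rewrite exprMn coefXnM coef_X1n. Qed.

Lemma coef_symQP k i : (symQ * symP ^+ k)`_i =
  (if (i < k.+1)%N then 0 else 'C(k, i - k.+1)%:R) *+ 2
  + (if (i < k)%N then 0 else 'C(k, i - k)%:R).
Proof.
rewrite mulrDl mul1r coefD coef_symP; congr (_ + _).
by rewrite mulrnAl coefMn exprMn mulrA -exprS coefXnM coef_X1n.
Qed.

End Coefficients.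

(** * Bases of even and odd polynomials, and the block decomposition *)

Section SplitDeterminant.

Implicit Types (i j k l : nat).

Variable x : nat.
Notation mu := (2 * x + 1)%N.

(** [left_poly k] has degree k and [right_poly k] has degree mu + k. Under t -> -1 - t each is even
    or odd according to its degree, where mu is odd. *)
Definition left_poly k : {poly rat} :=
  if odd k then symQ * symP ^+ k./2 else symP ^+ k./2.
Definition right_poly k : {poly rat} :=
  if odd k then symP ^+ (x + 1 + k./2) else symQ * symP ^+ (x + k./2).

Lemma left_poly_reflect k : left_poly k \Po (- ('X + 1)) = (-1) ^+ k *: left_poly k.
Proof.
rewrite -signr_odd /left_poly; case: odd; last by rewrite expr0 scale1r symP_reflect.
by rewrite expr1 scaleN1r symQP_reflect.
Qed.

Lemma right_poly_reflect k :
  right_poly k \Po (- ('X + 1)) = - (-1) ^+ k *: right_poly k.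
Proof.
rewrite -signr_odd /right_poly; case: odd; last by rewrite expr0 scaleN1r symQP_reflect.
by rewrite expr1 opprK scale1r symP_reflect.
Qed.

Lemma left_poly_high k j : (k < j)%N -> (left_poly k)`_j = 0.
Proof.
move=> kj; have := odd_double_half k; rewrite -mul2n /left_poly.
case: odd => /= E; rewrite ?coef_symQP ?coef_symP; do ?[case: ifP => _];
  rewrite ?bin_small ?mul0rn ?addr0 //; lia.
Qed.

Lemma left_poly_lead k : (left_poly k)`_k = if odd k then 2 else 1.
Proof.
have := odd_double_half k; rewrite -mul2n /left_poly.
case: odd => /= E; rewrite ?coef_symQP ?coef_symP; (do ?[rewrite ifF; last by lia]).
  rewrite (_ : k - _ = k./2)%N; last by lia.
  by rewrite binn bin_small ?addr0 //; lia.
by rewrite (_ : k - _ = k./2)%N ?binn //; lia.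
Qed.

Lemma right_poly_high k j : (mu + k < j)%N -> (right_poly k)`_j = 0.
Proof.
move=> kj; have := odd_double_half k; rewrite -mul2n /right_poly.
case: odd => /= E; rewrite ?coef_symQP ?coef_symP; do ?[case: ifP => _];
  rewrite ?bin_small ?mul0rn ?addr0 //; lia.
Qed.

Lemma right_poly_lead k : (right_poly k)`_(mu + k) = if odd k then 1 else 2.
Proof.
have := odd_double_half k; rewrite -mul2n /right_poly.
case: odd => /= E; rewrite ?coef_symQP ?coef_symP; (do ?[rewrite ifF; last by lia]).
  by rewrite (_ : _ - _ = x + 1 + k./2)%N ?binn //; lia.
rewrite (_ : _ - _ = x + k./2)%N; last by lia.
by rewrite binn bin_small ?addr0 //; lia.
Qed.

Definition pairing k l : rat := \sum_(j < k.+1) (left_poly k)`_j * (right_poly l)`_(mu + j).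

Lemma bin_convolution i j N : (j < N)%N ->
  \sum_(k < N) ('C(i, k) * 'C(mu + j, mu + k))%N = 'C(mu + i + j, j).
Proof.
move=> jN; rewrite (_ : mu + i + j = i + (mu + j))%N; last by lia.
rewrite -binomial.Vandermonde (big_ord_widen N (fun k => 'C(i, k) * 'C(mu + j, j - k))%N) //.
rewrite [RHS]big_mkcond; apply: eq_bigr => k _ /=; case: ifP => jk; last first.
  by rewrite ['C(mu + j, _)]bin_small ?muln0 //; lia.
by congr (_ * _)%N; rewrite -bin_sub; [congr 'C(_, _); lia | lia].
Qed.

(** Even indices come first, then odd ones, so that pairs of opposite parity fill the off-diagonal
    blocks. *)
Definition checker_index n1 n2 (i : 'I_(n1 + n2)) : nat :=
  match split i with inl a => (2 * a)%N | inr b => (2 * b + 1)%N end.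

Lemma size_left_poly k : (size (left_poly k) <= k.+1)%N.
Proof. by apply/leq_sizeP => j; apply: left_poly_high. Qed.

Lemma size_right_poly k : (size (right_poly k) <= mu + k.+1)%N.
Proof. by apply/leq_sizeP => j kj; apply: right_poly_high; lia. Qed.

Definition left_mx m : 'M[rat]_m := \matrix_(k, i) ((left_poly k)`_i * (-1) ^+ i).
Definition right_mx m : 'M[rat]_m := \matrix_(j, k) ((-1) ^+ j * (right_poly k)`_(mu + j)).

Lemma left_mx_pascal m : left_mx m *m (\matrix_(i < m, j < m) 'C(i, j)%:R) =
  \matrix_(k, j) ((-1) ^+ k * (left_poly k)`_j).
Proof.
apply/matrixP => k j; rewrite !mxE; under eq_bigr do rewrite !mxE.
apply: reflect_coef; first exact: left_poly_reflect.
by apply: leq_trans (size_left_poly k) _; exact: ltn_ord.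
Qed.

Lemma pascal_right_mx m : (\matrix_(i < m, j < m) 'C(mu + j, mu + i)%:R) *m right_mx m =
  \matrix_(i, k) ((-1) ^+ k * (right_poly k)`_(mu + i)).
Proof.
apply/matrixP => i k; rewrite !mxE; under eq_bigr do rewrite !mxE.
have sz : (size (right_poly k) <= mu + m)%N.
  by apply: leq_trans (size_right_poly k) _; rewrite leq_add2l ltn_ord.
have := reflect_coef (mu + i) (right_poly_reflect k) sz.
(* The coefficients below degree mu do not contribute, because C(j, mu + i) = 0 for j < mu. *)
rewrite big_split_ord /= big1 ?add0r => [E|j _]; last first.
  by rewrite bin_small ?mulr0 //; have := ltn_ord j; lia.
apply: oppr_inj; rewrite -mulNr -{}E -sumrN; apply: eq_bigr => j _.
have -> : (-1) ^+ (mu + j) = - (-1) ^+ j :> rat.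
  by rewrite exprD -signr_odd oddD oddM /= mulN1r.
by ring.
Qed.

(** Both matrices are triangular. At each index one leading coefficient is 2 and the other is 1, and
    the signs cancel in pairs. *)
Lemma det_left_right_mx m : \det (left_mx m) * \det (right_mx m) = 2 ^+ m.
Proof.
rewrite -(det_tr (right_mx m)) !det_trig; first last.
- apply/is_trig_mxP => i j ij; rewrite !mxE right_poly_high ?mulr0 //.
  by rewrite ltn_add2l.
- by apply/is_trig_mxP => i j ij; rewrite !mxE left_poly_high ?mul0r.
rewrite -big_split /= -[m in RHS]card_ord -prodr_const; apply: eq_bigr => i _.
rewrite !mxE left_poly_lead right_poly_lead.
rewrite mulrA -[_ * _ * _ ^+ _]mulrA -expr2 sqrr_sign mulr1.
by case: odd; rewrite ?mulr1 ?mul1r.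
Qed.

(** For the summand 1 the signs (-1)^i of the two outer factors cancel; for the binomial summand
    each outer factor absorbs one Pascal matrix and yields the sign of its reflection. *)
Lemma left_mx_binomial_right_mx m :
  left_mx m *m (1%:M + \matrix_(i < m, j < m) 'C(mu + i + j, j)%:R) *m right_mx m =
  \matrix_(k, l) ((1 + (-1) ^+ (k + l)) * pairing k l).
Proof.
have -> : \matrix_(i < m, j < m) 'C(mu + i + j, j)%:R =
    (\matrix_(i < m, j < m) 'C(i, j)%:R) *m (\matrix_(i < m, j < m) 'C(mu + j, mu + i)%:R) :> 'M[rat]_m.
  apply/matrixP => i j; rewrite !mxE -(bin_convolution i (ltn_ord j)) natr_sum.
  by apply: eq_bigr => k _; rewrite !mxE natrM.
rewrite mulmxDr mulmx1 mulmxDl mulmxA left_mx_pascal -mulmxA pascal_right_mx.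
apply/matrixP => k l; rewrite !mxE mulrDl mul1r.
have pE : pairing k l = \sum_(j < m) (left_poly k)`_j * (right_poly l)`_(mu + j).
  rewrite /pairing (big_ord_widen m (fun j => (left_poly k)`_j * (right_poly l)`_(mu + j))) //.
  rewrite big_mkcond; apply: eq_bigr => j _ /=.
  by case: ltnP => // kj; rewrite left_poly_high ?mul0r.
rewrite pE; congr (_ + _).
  by apply: eq_bigr => j _; rewrite !mxE mulrA -[_ * _ * _ ^+ _]mulrA -expr2 sqrr_sign mulr1.
by rewrite mulr_sumr; apply: eq_bigr => j _; rewrite !mxE exprD; ring.
Qed.

(** Entries with k + l odd vanish and the others carry a factor 2. The factors 2 from the two blocks
    cancel against the determinant of the base changes. *)
Theorem det_binomial_split n1 n2 : (n2 <= n1 <= n2.+1)%N ->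
  \det (1%:M + \matrix_(i < n1 + n2, j < n1 + n2) 'C(mu + i + j, j)%:R) =
  \det (\matrix_(a < n1, b < n1) pairing (2 * a) (2 * b)) *
  \det (\matrix_(a < n2, b < n2) pairing (2 * a + 1) (2 * b + 1)) :> rat.
Proof.
move=> n12; set M := (n1 + n2)%N.
have idx_lt (i : 'I_M) : (checker_index i < M)%N.
  by rewrite /checker_index /M; case: (split i) => a; have := ltn_ord a; lia.
pose h (i : 'I_M) : 'I_M := Ordinal (idx_lt i).
have h_inj : injective h.
  move=> i j /(congr1 val) /=; rewrite /checker_index -[i]splitK -[j]splitK !unsplitK.
  case: (split i) (split j) => a [] b E.
  - by congr (unsplit (inl _)); apply: val_inj; move: E; rewrite /=; lia.
  - by exfalso; lia.
  - by exfalso; lia.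
  - by congr (unsplit (inr _)); apply: val_inj; move: E; rewrite /=; lia.
have H := congr1 determinant (left_mx_binomial_right_mx M).
rewrite !det_mulmx mulrAC det_left_right_mx -[RHS](det_mxsub_inj _ h_inj) in H.
have two_neq0 : (2 : rat) ^+ M != 0 by rewrite expf_neq0.
apply: (mulfI two_neq0); rewrite {}H.
transitivity (\det (block_mx (2 *: \matrix_(a < n1, b < n1) pairing (2 * a) (2 * b)) 0
   0 (2 *: \matrix_(a < n2, b < n2) pairing (2 * a + 1) (2 * b + 1)))).
  congr (\det _); apply/matrixP => i j.
  rewrite !mxE /= /checker_index; case: splitP => a _; rewrite !mxE; case: splitP => b _;
    by rewrite !mxE -signr_odd !oddD /=; case: (odd a); case: (odd b);
      rewrite /= ?expr1 ?expr0 ?subrr ?mul0r.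
by rewrite det_ublock !detZ exprD; ring.
Qed.

End SplitDeterminant.

(** * Closed forms of the block entries *)

Section PairingValues.

Variable x : nat.
Notation mu := (2 * x + 1)%N.

(** Reversing the left polynomial at degree k turns the pairing into a single coefficient of a
    product. *)
Lemma pairing_rev (k l : nat) (p : {poly rat}) :
  (forall j, (j <= k)%N -> p`_j = (left_poly k)`_(k - j)) ->
  (forall j, (k < j)%N -> p`_j = 0) ->
  pairing x k l = (p * right_poly x l)`_(mu + k).
Proof.
move=> p_lo p_hi; rewrite coefM /pairing (reindex_inj rev_ord_inj) /=.
rewrite (big_ord_widen (mu + k).+1
  (fun j => (left_poly k)`_(k.+1 - j.+1) * (right_poly x l)`_(mu + (k.+1 - j.+1)))); last by lia.
rewrite big_mkcond; apply: eq_bigr => j _ /=.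
case: ltnP => jk; last by rewrite p_hi ?mul0r.
by rewrite p_lo ?subSS; [congr (_ * _`_ _); lia | lia].
Qed.

Lemma pairing_even (a b : nat) : pairing x (2 * a) (2 * b) =
  (3 * a + 2 * x + 2)%:R * ((a + b + x)`!%:R * ifact (2 * a%:Z + x%:Z + 1 - b%:Z)
                            * ifact (2 * b%:Z - a%:Z)).
Proof.
have half2 c : ((2 * c)./2 = c)%N by lia.
have odd2 c : odd (2 * c) = false by rewrite oddM.
(* The reversal of t^a (t + 1)^a at degree 2a. *)
rewrite (@pairing_rev _ _ (('X + 1) ^+ a)) => [|j ja|j ja]; first last.
- by rewrite coef_X1n bin_small //; lia.
- rewrite coef_X1n /left_poly odd2 half2 coef_symP.
  case: ifP => H; first by rewrite bin_small //; lia.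
  by rewrite -bin_sub; [congr ('C(_, _)%:R); lia | lia].
rewrite /right_poly odd2 half2.
have -> : ('X + 1) ^+ a * (('X *+ 2 + 1) * ('X * ('X + 1)) ^+ (x + b)) =
   ('X^(x + b + 1) * ('X + 1) ^+ (a + b + x)) *+ 2 + 'X^(x + b) * ('X + 1) ^+ (a + b + x)
   :> {poly rat}.
  by rewrite exprMn !exprD; ring.
rewrite coefD coefMn !coef_XnX1n.
set z : int := 2 * a%:Z + x%:Z + 1 - b%:Z; set w : int := 2 * b%:Z - a%:Z.
rewrite (_ : (mu + 2 * a)%N%:Z - (x + b + 1)%N%:Z = z - 1); last by rewrite /z; lia.
rewrite (_ : (mu + 2 * a)%N%:Z - (x + b)%N%:Z = z); last by rewrite /z; lia.
rewrite (_ : (a + b + x)%N%:Z - (z - 1) = w); last by rewrite /z /w; lia.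
rewrite (_ : (a + b + x)%N%:Z - z = w - 1); last by rewrite /z /w; lia.
(* Both terms now share the inverse factorials of z and w, leaving the linear factor 2z + w. *)
rewrite !ifact_pred.
have -> : (3 * a + 2 * x + 2)%:R = z%:~R * 2 + w%:~R :> rat.
  rewrite /z /w; ring.
by rewrite mulr2n; ring.
Qed.

Lemma pairing_odd (a b : nat) : pairing x (2 * a + 1) (2 * b + 1) =
  (3 * b + x + 3)%:R * ((a + b + x + 1)`!%:R * ifact (2 * a%:Z + x%:Z + 1 - b%:Z)
                            * ifact (2 * b%:Z - a%:Z + 1)).
Proof.
have half1 c : ((2 * c + 1)./2 = c)%N by lia.
have odd1 c : odd (2 * c + 1) by rewrite oddD oddM.
(* The reversal of (2t + 1) t^a (t + 1)^a at degree 2a + 1. *)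
rewrite (@pairing_rev _ _ (('X + 2%:P) * ('X + 1) ^+ a)) => [|j ja|j ja]; first last.
- rewrite mulrDl coefD coefXM coefCM !coef_X1n.
  by case: eqP => H; rewrite !bin_small ?mulr0 ?addr0 //; lia.
- rewrite mulrDl coefD coefXM coefCM !coef_X1n /left_poly odd1 half1 coef_symQP addrC.
  congr (_ + _).
    rewrite mulr_natl; case: ifP => H; first by rewrite bin_small //; lia.
    by rewrite -bin_sub; [congr ('C(_, _)%:R *+ 2); lia | lia].
  case: eqP => H; first by rewrite ifF ?bin_small //; lia.
  case: ifP => H'; first by rewrite bin_small //; lia.
  by rewrite -bin_sub; [congr ('C(_, _)%:R); lia | lia].
rewrite /right_poly odd1 half1.
have -> : ('X + 2%:P) * ('X + 1) ^+ a * ('X * ('X + 1)) ^+ (x + 1 + b) =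
   ('X^(x + b + 1) * ('X + 1) ^+ (a + b + x + 1)) *+ 2 + 'X^(x + b + 2) * ('X + 1) ^+ (a + b + x + 1)
   :> {poly rat}.
  rewrite exprMn !exprD (_ : 2%:P = 2 :> {poly rat}); last by rewrite rmorph_nat.
  by ring.
rewrite coefD coefMn !coef_XnX1n.
set z : int := 2 * a%:Z + x%:Z + 1 - b%:Z; set w : int := 2 * b%:Z - a%:Z + 1.
rewrite (_ : (mu + (2 * a + 1))%N%:Z - (x + b + 1)%N%:Z = z); last by rewrite /z; lia.
rewrite (_ : (mu + (2 * a + 1))%N%:Z - (x + b + 2)%N%:Z = z - 1); last by rewrite /z; lia.
rewrite (_ : (a + b + x + 1)%N%:Z - z = w - 1); last by rewrite /z /w; lia.
rewrite (_ : (a + b + x + 1)%N%:Z - (z - 1) = w); last by rewrite /z /w; lia.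
rewrite !ifact_pred.
have -> : (3 * b + x + 3)%:R = z%:~R + w%:~R * 2 :> rat.
  rewrite /z /w; ring.
by rewrite mulr2n; ring.
Qed.

End PairingValues.

(** * An LU decomposition *)

Section LUDecomposition.

Variable v : nat.
Hypothesis v_gt0 : (0 < v)%N.
Implicit Types a b k n : nat.

(* Its determinant is, up to row and column scaling, that of Mills, Robbins and Rumsey. *)
Definition mrr a b : rat :=
  (a + b + v)`!%:R * ifact (2 * a%:Z + v%:Z - b%:Z) * ifact (2 * b%:Z - a%:Z + 1).

Definition half_poch a : rat := \prod_(i < a) (v%:R + i%:R + 2^-1).

Definition lower0 k a : rat :=
  (- 4%:R) ^+ a * ((2 * k - a)`!)%:R * ifact a%:Z * ifact (k%:Z - a%:Z) * half_poch a
  * ((v + k + a)`!)%:R * ifact (2 * v + 2 * k + a + 1)%N%:Z.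

(** Row k of a triangular L for which L times [mrr] is upper triangular, so L is, up to scaling, the
    inverse of the usual lower factor. The factor 1/(k - a)! vanishes for a > k. *)
Definition lower k a : rat := (3 * a + 2 * v + 1)%:R * lower0 k a.

Definition upper k b : rat := \sum_(0 <= a < k.+1) lower k a * mrr a b.

Lemma ifactE (y z : int) : z = y - 1 -> ifact z = y%:~R * ifact y.
Proof. by move=> ->; exact: ifact_pred. Qed.

Lemma half_pochS a : half_poch a.+1 = half_poch a * (v%:R + a%:R + 2^-1).
Proof. by rewrite /half_poch big_ord_recr. Qed.

(* [cert_b] and, below, [cert_k] come from Zeilberger's algorithm. *)
Definition cert_b k b a : rat :=
  a%:R * (2 * v + 2 * k + a + 1)%:R * (2 * a%:R - b%:R + v%:R - 1) * (2 * a%:R - b%:R + v%:R)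
  * ((- 4%:R) ^+ a * ((2 * k + 1 - a)`!)%:R * ifact a%:Z * ifact (k%:Z - a%:Z) * half_poch a
     * ((v + k + a)`!)%:R * ifact (2 * v + 2 * k + a + 1)%N%:Z)
  * ((a + b + v)`!%:R * ifact (2 * a%:Z + v%:Z - b%:Z) * ifact (2 * b%:Z - a%:Z + 3)).

Lemma cert_b_step k b a : (a <= k)%N ->
  (2 * k + 2 + b + v)%:R * (b + v + 1)%:R * (2 * k%:R + v%:R - b%:R) * (lower k a * mrr a b)
  + 2 * (k%:R - b%:R - 1) * (2 * b + 3)%:R * (v + k + b + 2)%:R * (lower k a * mrr a b.+1)
  = (3 * b + v + 4)%:R * (cert_b k b a - cert_b k b a.+1).
Proof.
move=> ak; rewrite /lower /lower0 /mrr /cert_b half_pochS exprS.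
rewrite (_ : 2 * k + 1 - a = (2 * k - a).+1)%N; last by lia.
rewrite (_ : 2 * k + 1 - a.+1 = 2 * k - a)%N; last by lia.
rewrite (_ : v + k + a.+1 = (v + k + a).+1)%N; last by lia.
rewrite (_ : a + b.+1 + v = (a + b + v).+1)%N; last by lia.
rewrite (_ : a.+1 + b + v = (a + b + v).+1)%N; last by lia.
(* Each inverse factorial is expressed through the one with the largest argument, which is valid at
   negative arguments too; only a polynomial identity remains. *)
rewrite (@ifactE a.+1%:Z a%:Z); last by lia.
rewrite (@ifactE (k%:Z - a%:Z) (k%:Z - a.+1%:Z)); last by lia.
rewrite (@ifactE (2 * v + 2 * k + a.+1 + 1)%N%:Z (2 * v + 2 * k + a + 1)%N%:Z); last by lia.
rewrite (_ : 2 * b%:Z - a.+1%:Z + 3 = 2 * b%:Z - a%:Z + 2); last by lia.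
rewrite (_ : 2 * b.+1%:Z - a%:Z + 1 = 2 * b%:Z - a%:Z + 3); last by lia.
rewrite (@ifactE (2 * b%:Z - a%:Z + 2) (2 * b%:Z - a%:Z + 1)); last by lia.
rewrite (@ifactE (2 * b%:Z - a%:Z + 3) (2 * b%:Z - a%:Z + 2)); last by lia.
rewrite (@ifactE (2 * a%:Z + v%:Z - b%:Z) (2 * a%:Z + v%:Z - b.+1%:Z)); last by lia.
rewrite (@ifactE (2 * a%:Z + v%:Z - b%:Z + 1) (2 * a%:Z + v%:Z - b%:Z)); last by lia.
rewrite (@ifactE (2 * a.+1%:Z + v%:Z - b%:Z) (2 * a%:Z + v%:Z - b%:Z + 1)); last by lia.
rewrite !factS !natrM.
have -> : (2 * k - a).+1%:R = 2 * k%:R - a%:R + 1 :> rat.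
  by rewrite -natr1 natrB ?natrM //; lia.
move: (ifact a.+1%:Z) (ifact (k%:Z - a%:Z)) (ifact (2 * v + 2 * k + a.+1 + 1)%N%:Z)
  (ifact (2 * b%:Z - a%:Z + 3)) (ifact (2 * a.+1%:Z + v%:Z - b%:Z))
  ((2 * k - a)`!%:R) ((a + b + v)`!%:R) ((v + k + a)`!%:R) (half_poch a) ((-4%:R) ^+ a : rat).
move=> i1 i2 i3 i4 i5 f1 f2 f3 h p.
by field.
Qed.

(** The sum telescopes, and both ends vanish: at a = 0 by the factor a, at a = k + 1 by the inverse
    factorial of -1. *)
Lemma upper_next_col k b :
  (2 * k + 2 + b + v)%:R * (b + v + 1)%:R * (2 * k%:R + v%:R - b%:R) * upper k b
  + 2 * (k%:R - b%:R - 1) * (2 * b + 3)%:R * (v + k + b + 2)%:R * upper k b.+1 = 0.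
Proof.
rewrite /upper !mulr_sumr -big_split /=.
under eq_big_nat => a /andP[_ ak] do rewrite cert_b_step // -opprB mulrN.
rewrite sumrN -mulr_sumr telescope_sumr //.
have -> : cert_b k b 0 = 0 by rewrite /cert_b !mul0r.
have -> : cert_b k b k.+1 = 0.
  rewrite /cert_b (_ : k%:Z - k.+1%:Z = -1); last by lia.
  by rewrite [ifact (-1)]/ifact !(mulr0, mul0r).
by rewrite subrr mulr0 oppr0.
Qed.

Definition cert_k k b a : rat :=
  (a%:R + v%:R + 1 + b%:R) * a%:R * (2 * v + 2 * k + a + 3)%:R
  * (2 * a%:R - b%:R + v%:R - 1) * (2 * a%:R - b%:R + v%:R)
  * ((- 4%:R) ^+ a * ((2 * k + 1 - a)`!)%:R * ifact a%:Z * ifact (k%:Z + 1 - a%:Z) * half_poch a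
     * ((v + k + a)`!)%:R * ifact (2 * v + 2 * k + a + 3)%N%:Z)
  * mrr a b.

Lemma cert_k_step k b a : (a <= k)%N ->
  (2 * k%:R + v%:R + 1 - b%:R) * (2 * k%:R + v%:R + 2 - b%:R) * (k + 2 + v + b)%:R
    * (lower k.+1 a * mrr a b)
  + (b%:R - k%:R) * (v + 2 * k + b + 2)%:R * (v + 2 * k + b + 3)%:R * (lower k a * mrr a b)
  = (v + 2 * k + 2)%:R * (cert_k k b a - cert_k k b a.+1).
Proof.
move=> ak; rewrite /cert_k /lower /lower0 /mrr half_pochS exprS.
rewrite (_ : 2 * k.+1 - a = (2 * k - a).+2)%N; last by lia.
rewrite (_ : 2 * k + 1 - a = (2 * k - a).+1)%N; last by lia.
rewrite (_ : 2 * k + 1 - a.+1 = 2 * k - a)%N; last by lia.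
rewrite (_ : v + k + a.+1 = (v + k + a).+1)%N; last by lia.
rewrite (_ : v + k.+1 + a = (v + k + a).+1)%N; last by lia.
rewrite (_ : a.+1 + b + v = (a + b + v).+1)%N; last by lia.
rewrite (_ : 2 * v + 2 * k.+1 + a + 1 = 2 * v + 2 * k + a + 3)%N; last by lia.
rewrite (@ifactE a.+1%:Z a%:Z); last by lia.
rewrite (_ : k.+1%:Z - a%:Z = k%:Z + 1 - a%:Z); last by lia.
rewrite (_ : k%:Z + 1 - a.+1%:Z = k%:Z - a%:Z); last by lia.
rewrite (@ifactE (k%:Z + 1 - a%:Z) (k%:Z - a%:Z)); last by lia.
rewrite (@ifactE (2 * v + 2 * k + a + 2)%N%:Z (2 * v + 2 * k + a + 1)%N%:Z); last by lia.
rewrite (@ifactE (2 * v + 2 * k + a + 3)%N%:Z (2 * v + 2 * k + a + 2)%N%:Z); last by lia.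
rewrite (@ifactE (2 * v + 2 * k + a.+1 + 3)%N%:Z (2 * v + 2 * k + a + 3)%N%:Z); last by lia.
rewrite (_ : 2 * b%:Z - a.+1%:Z + 1 = 2 * b%:Z - a%:Z); last by lia.
rewrite (@ifactE (2 * b%:Z - a%:Z + 1) (2 * b%:Z - a%:Z)); last by lia.
rewrite (@ifactE (2 * a%:Z + v%:Z - b%:Z + 1) (2 * a%:Z + v%:Z - b%:Z)); last by lia.
rewrite (@ifactE (2 * a.+1%:Z + v%:Z - b%:Z) (2 * a%:Z + v%:Z - b%:Z + 1)); last by lia.
rewrite !factS !natrM.
have -> : (2 * k - a).+2%:R = 2 * k%:R - a%:R + 2 :> rat.
  by rewrite -addn2 natrD natrB ?natrM //; lia.
have -> : (2 * k - a).+1%:R = 2 * k%:R - a%:R + 1 :> rat.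
  by rewrite -natr1 natrB ?natrM //; lia.
move: (ifact a.+1%:Z) (ifact (k%:Z + 1 - a%:Z)) (ifact (2 * v + 2 * k + a.+1 + 3)%N%:Z)
  (ifact (2 * b%:Z - a%:Z + 1)) (ifact (2 * a.+1%:Z + v%:Z - b%:Z))
  ((2 * k - a)`!%:R) ((a + b + v)`!%:R) ((v + k + a)`!%:R) (half_poch a) ((-4%:R) ^+ a : rat).
move=> i1 i2 i3 i4 i5 f1 f2 f3 h p.
by field.
Qed.

(** [upper k.+1] has one summand more than [upper k]; this summand cancels the end value of the
    telescoping sum, which need not vanish. *)
Lemma cert_k_last k b :
  (2 * k%:R + v%:R + 1 - b%:R) * (2 * k%:R + v%:R + 2 - b%:R) * (k + 2 + v + b)%:R
    * (lower k.+1 k.+1 * mrr k.+1 b)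
  = (v + 2 * k + 2)%:R * cert_k k b k.+1.
Proof.
rewrite /cert_k /lower /lower0 /mrr.
rewrite (_ : 2 * k.+1 - k.+1 = k.+1)%N; last by lia.
rewrite (_ : 2 * k + 1 - k.+1 = k)%N; last by lia.
rewrite (_ : v + k.+1 + k.+1 = (v + k + k.+1).+1)%N; last by lia.
rewrite (_ : 2 * v + 2 * k.+1 + k.+1 + 1 = 2 * v + 2 * k + k.+1 + 3)%N; last by lia.
rewrite (_ : k.+1%:Z - k.+1%:Z = k%:Z + 1 - k.+1%:Z); last by lia.
rewrite !factS !natrM; ring.
Qed.

Lemma upper_next_row k b :
  (2 * k%:R + v%:R + 1 - b%:R) * (2 * k%:R + v%:R + 2 - b%:R) * (k + 2 + v + b)%:R * upper k.+1 b
  + (b%:R - k%:R) * (v + 2 * k + b + 2)%:R * (v + 2 * k + b + 3)%:R * upper k b = 0.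
Proof.
rewrite /upper big_nat_recr //= mulrDr cert_k_last addrAC !mulr_sumr -big_split /=.
under eq_big_nat => a /andP[_ ak] do rewrite cert_k_step // -opprB mulrN.
rewrite sumrN -mulr_sumr telescope_sumr //.
have -> : cert_k k b 0 = 0 by rewrite /cert_k mulr0 !mul0r.
by rewrite subr0 addNr.
Qed.

(** At b = k the coefficient b - k removes [upper k] from the row recurrence; the recurrence then
    carries the zero to all larger k, its leading coefficient being positive for b <= k. *)
Lemma upper_below k b : (b < k)%N -> upper k b = 0.
Proof.
elim: k => // k IH; rewrite ltnS leq_eqVlt => /orP[/eqP->|bk].
  have := upper_next_row k k; rewrite subrr !mul0r addr0 => /eqP.
  rewrite !mulf_eq0 => /orP[|/eqP//].
  have -> : 2 * k%:R + v%:R + 1 - k%:R = (k + v + 1)%:R :> rat by ring.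
  have -> : 2 * k%:R + v%:R + 2 - k%:R = (k + v + 2)%:R :> rat by ring.
  by rewrite !pnatr_eq0; lia.
have := upper_next_row k b; rewrite (IH bk) mulr0 addr0 => /eqP.
rewrite !mulf_eq0 => /orP[|/eqP//].
have -> : 2 * k%:R + v%:R + 1 - b%:R = (2 * k + v + 1 - b)%:R :> rat.
  by rewrite natrB; [ring | lia].
have -> : 2 * k%:R + v%:R + 2 - b%:R = (2 * k + v + 2 - b)%:R :> rat.
  by rewrite natrB; [ring | lia].
by rewrite !pnatr_eq0; lia.
Qed.

(** One column step from (k, k) to (k, k + 1), followed by one row step to (k + 1, k + 1). *)
Lemma upper_diag_rec k :
  2 * (2 * k + 3)%:R * (v + 2 * k + 2)%:R * (v + 2 * k + 3)%:R * upper k.+1 k.+1 =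
  - ((v + 3 * k + 2)%:R * (v + 3 * k + 3)%:R * (v + 3 * k + 4)%:R * upper k k).
Proof.
have E1 := upper_next_col k k; have E2 := upper_next_row k k.+1.
have nz : ((k + v)%:R * (k + v + 1)%:R : rat) != 0.
  by rewrite mulf_neq0 // pnatr_eq0; lia.
apply: (mulfI nz).
have {}E1 : (v + 3 * k + 2)%:R * (k + v + 1)%:R * (k + v)%:R * upper k k =
    2 * (2 * k + 3)%:R * (v + 2 * k + 2)%:R * upper k k.+1.
  by apply/eqP; rewrite -subr_eq0 -E1; apply/eqP; ring.
have {}E2 : (k + v)%:R * (k + v + 1)%:R * (v + 2 * k + 3)%:R * upper k.+1 k.+1 =
    - ((v + 3 * k + 3)%:R * (v + 3 * k + 4)%:R * upper k k.+1).
  by apply/eqP; rewrite -subr_eq0 -E2; apply/eqP; ring.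
transitivity (2 * (2 * k + 3)%:R * (v + 2 * k + 2)%:R *
   ((k + v)%:R * (k + v + 1)%:R * (v + 2 * k + 3)%:R * upper k.+1 k.+1)); first by ring.
rewrite {}E2.
transitivity (- ((v + 3 * k + 3)%:R * (v + 3 * k + 4)%:R *
  (2 * (2 * k + 3)%:R * (v + 2 * k + 2)%:R * upper k k.+1))); first by ring.
by rewrite -E1; ring.
Qed.

(** The k-th pivot of [mrr], that is, the quotient of the diagonal entries of U and L. *)
Definition mrr_ratio k : rat :=
  (k.+1)`!%:R * (v + 3 * k + 1)`!%:R * (v + k - 1)`!%:R * (2 * v + 3 * k)`!%:R
  / ((2 * k + 2)`!%:R * (v + 2 * k)`!%:R * (v + 2 * k + 1)`!%:R * (2 * v + 2 * k - 1)`!%:R).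

Lemma fact_neq0 n : (n`!%:R : rat) != 0.
Proof. by rewrite pnatr_eq0 -lt0n fact_gt0. Qed.

Lemma mrr_ratioS k : mrr_ratio k.+1 = mrr_ratio k *
  ((k + 2)%:R * (v + 3 * k + 2)%:R * (v + 3 * k + 3)%:R * (v + 3 * k + 4)%:R * (v + k)%:R
    * (2 * v + 3 * k + 1)%:R * (2 * v + 3 * k + 2)%:R * (2 * v + 3 * k + 3)%:R
  / ((2 * k + 3)%:R * (2 * k + 4)%:R * (v + 2 * k + 1)%:R * (v + 2 * k + 2)%:R ^+ 2
    * (v + 2 * k + 3)%:R * (2 * v + 2 * k)%:R * (2 * v + 2 * k + 1)%:R)).
Proof.
rewrite /mrr_ratio.
rewrite (_ : v + 3 * k.+1 + 1 = (v + 3 * k + 1).+3)%N; last by lia.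
rewrite (_ : v + k.+1 - 1 = (v + k - 1).+1)%N; last by lia.
rewrite (_ : 2 * v + 3 * k.+1 = (2 * v + 3 * k).+3)%N; last by lia.
rewrite (_ : 2 * k.+1 + 2 = (2 * k + 2).+2)%N; last by lia.
rewrite (_ : v + 2 * k.+1 + 1 = (v + 2 * k + 1).+2)%N; last by lia.
rewrite (_ : v + 2 * k.+1 = (v + 2 * k).+2)%N; last by lia.
rewrite (_ : 2 * v + 2 * k.+1 - 1 = (2 * v + 2 * k - 1).+2)%N; last by lia.
rewrite [k.+2`!]factS !(factS _.+2) !(factS _.+1) ?factS.
rewrite (_ : (v + k - 1).+1 = v + k)%N; last by lia.
rewrite (_ : (2 * v + 2 * k - 1).+2 = 2 * v + 2 * k + 1)%N; last by lia.
rewrite (_ : (2 * v + 2 * k - 1).+1 = 2 * v + 2 * k)%N; last by lia.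
have n1 := fact_neq0 (2 * k + 2); have n2 := fact_neq0 (v + 2 * k).
have n3 := fact_neq0 (v + 2 * k + 1); have n4 := fact_neq0 (2 * v + 2 * k - 1).
have n5 := fact_neq0 (v + k - 1); have n6 := fact_neq0 k.+1.
rewrite !natrM; field.
rewrite n1 n2 n3 n4 /=.
have v0 : 0 < v%:R :> rat by rewrite ltr0n.
have k0 : 0 <= k%:R :> rat by rewrite ler0n.
by do ?[apply/andP; split]=> //; apply: lt0r_neq0; lra.
Qed.

Lemma lower_diagS k : lower k.+1 k.+1 = - lower k k *
  (2 * (2 * v + 2 * k + 1)%:R * (v + 2 * k + 1)%:R * (v + 2 * k + 2)%:R * (2 * v + 3 * k + 4)%:R
  / ((2 * v + 3 * k + 1)%:R * (2 * v + 3 * k + 2)%:R * (2 * v + 3 * k + 3)%:R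
     * (2 * v + 3 * k + 4)%:R)).
Proof.
rewrite /lower /lower0 half_pochS exprS !subrr.
rewrite (_ : 2 * k.+1 - k.+1 = k.+1)%N; last by lia.
rewrite (_ : 2 * k - k = k)%N; last by lia.
rewrite (_ : v + k.+1 + k.+1 = (v + k + k).+2)%N; last by lia.
rewrite (_ : 2 * v + 2 * k.+1 + k.+1 + 1 = (2 * v + 2 * k + k + 1).+3)%N; last by lia.
rewrite !ifact_nat [k.+1`!]factS (factS _.+1) (factS (v + k + k)) !(factS _.+2) !(factS _.+1)
  (factS (2 * v + 2 * k + k + 1)).
have n1 := fact_neq0 k; have n2 := fact_neq0 (2 * v + 2 * k + k + 1).
have v0 : 0 < v%:R :> rat by rewrite ltr0n.
have k0 : 0 <= k%:R :> rat by rewrite ler0n.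
rewrite !natrM; field; rewrite n1 n2 /=.
by do ?[apply/andP; split]=> //; apply: lt0r_neq0; lra.
Qed.

Lemma upper_diag k : upper k k = mrr_ratio k * lower k k.
Proof.
have v0 : 0 < v%:R :> rat by rewrite ltr0n.
elim: k => [|k IH].
  have -> : mrr_ratio 0 = 1.
    rewrite /mrr_ratio; have [w ->] : exists w, v = w.+1 by exists v.-1; lia.
    rewrite !(muln0, addn0, add0n) subn1 /= (_ : 2 * w.+1 - 1 = (2 * w).+1)%N; last by lia.
    rewrite (_ : 2 * w.+1 = (2 * w).+2)%N; last by lia.
    rewrite addn1 !factS fact0; have n1 := fact_neq0 w; have n2 := fact_neq0 (2 * w).
    have w0 : 0 <= w%:R :> rat by rewrite ler0n.
    rewrite !natrM; move: (w`!%:R) ((2 * w)`!%:R) n1 n2 => f1 f2 n1 n2.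
    field; rewrite n1 n2 /=.
    by do ?[apply/andP; split]=> //; apply: lt0r_neq0; lra.
  rewrite mul1r /upper big_nat1 /mrr (_ : 2 * 0%:Z + v%:Z - 0%:Z = v%:Z); last by lia.
  rewrite (_ : 2 * 0%:Z - 0%:Z + 1 = 1%N%:Z); last by lia.
  by rewrite !ifact_nat divff ?fact_neq0 // invr1 !mulr1.
have k0 : 0 <= k%:R :> rat by rewrite ler0n.
have H := upper_diag_rec k.
have nz : 2 * (2 * k + 3)%:R * (v + 2 * k + 2)%:R * (v + 2 * k + 3)%:R != 0 :> rat.
  by rewrite !mulf_neq0 // pnatr_eq0; lia.
apply: (mulfI nz); rewrite {}H {}IH mrr_ratioS lower_diagS.
move: (mrr_ratio k) (lower k k) => r l; field.
by do ?[apply/andP; split]=> //; apply: lt0r_neq0; lra.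
Qed.

Lemma lower_diag_neq0 k : lower k k != 0.
Proof.
have v0 : 0 < v%:R :> rat by rewrite ltr0n.
rewrite /lower /lower0 subrr !mulf_neq0 ?fact_neq0 ?expf_neq0 ?ifact_nat ?invr_neq0 ?fact_neq0 //.
  by rewrite pnatr_eq0; lia.
rewrite /half_poch; apply/prodf_neq0 => i _; apply: lt0r_neq0.
by have : 0 <= (nat_of_ord i)%:R :> rat by []; lra.
Qed.

(** In L M = U both L and U are triangular, and det L is nonzero and can be cancelled. *)
Theorem det_mrr n : \det (\matrix_(a < n, b < n) mrr a b) = \prod_(k < n) mrr_ratio k.
Proof.
pose L : 'M[rat]_n := \matrix_(k, a) lower k a.
have LM : L *m \matrix_(a < n, b < n) mrr a b = \matrix_(k, b) upper k b.
  apply/matrixP => k b; rewrite !mxE /upper big_mkord.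
  rewrite (big_ord_widen n (fun a => lower k a * mrr a b)) // [RHS]big_mkcond.
  apply: eq_bigr => a _; rewrite !mxE; case: ltnP => // ka.
  rewrite /lower /lower0 (_ : k%:Z - a%:Z = Negz (a - k).-1); last by rewrite NegzE; lia.
  by rewrite !(mulr0, mul0r).
have dL : \det L = \prod_(k < n) lower k k.
  rewrite det_trig; first by apply: eq_bigr => k _; rewrite mxE.
  apply/is_trig_mxP => k a ka; rewrite mxE /lower /lower0.
  rewrite (_ : k%:Z - a%:Z = Negz (a - k).-1); last by rewrite NegzE; lia.
  by rewrite !(mulr0, mul0r).
have dU : \det (\matrix_(k < n, b < n) upper k b) = \prod_(k < n) mrr_ratio k * \det L.
  rewrite -det_tr det_trig ?dL -?big_split.
    by apply: eq_bigr => k _; rewrite !mxE upper_diag.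
  by apply/is_trig_mxP => k b kb; rewrite !mxE upper_below.
have nz : \det L != 0 by rewrite dL; apply/prodf_neq0 => k _; exact: lower_diag_neq0.
by apply: (mulfI nz); rewrite -det_mulmx LM dU mulrC.
Qed.

End LUDecomposition.

(** * The product formulas *)

Lemma det_scale_rows (R : comNzRingType) n (c : 'I_n -> R) (A : 'M[R]_n) :
  \det (\matrix_(i, j) (c i * A i j)) = (\prod_i c i) * \det A.
Proof.
have -> : \matrix_(i, j) (c i * A i j) = diag_mx (\row_i c i) *m A.
  by rewrite mul_diag_mx; apply/matrixP => i j; rewrite !mxE.
by rewrite det_mulmx det_diag; congr (_ * _); apply: eq_bigr => i _; rewrite mxE.
Qed.

Lemma det_scale_cols (R : comNzRingType) n (c : 'I_n -> R) (A : 'M[R]_n) :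
  \det (\matrix_(i, j) (c j * A i j)) = (\prod_i c i) * \det A.
Proof.
rewrite -det_tr -[\det A]det_tr -det_scale_rows; congr (\det _).
by apply/matrixP => i j; rewrite !mxE.
Qed.

Section Assembly.

Variable x : nat.

Definition even_factor k : rat := (3 * k + 2 * x + 5)%:R * mrr_ratio (x + 2) k.
Definition odd_factor k : rat := (3 * k + x + 3)%:R * mrr_ratio (x + 1) k.

Lemma det_pairing_even n :
  \det (\matrix_(a < n.+1, b < n.+1) pairing x (2 * a) (2 * b)) =
  2 * \prod_(k < n) even_factor k.
Proof.
(* Below the corner, column 0 contains the inverse factorial of -a with a > 0, hence zeros. The
   corner is 2, and the remaining block is a row-scaled [mrr] with v = x + 2. *)
rewrite -[X in \det X](@submxK _ 1 n 1 n).
set A := (X in @dlsubmx _ 1 n 1 n X).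
have -> : @dlsubmx _ 1 n 1 n A = 0.
  apply/matrixP => i j; rewrite !mxE ord1 pairing_even /=.
  by rewrite !mulr0.
rewrite (@det_ublock _ 1 n) det_mx11; congr (_ * _).
  transitivity (pairing x (2 * 0) (2 * 0)); first by rewrite !mxE.
  rewrite pairing_even !add0n.
  rewrite (_ : 2 * 0%:Z + x%:Z + 1 - 0%:Z = x.+1%:Z); last by lia.
  rewrite (_ : 2 * 0%:Z - 0%:Z = 0%:Z); last by lia.
  rewrite !ifact_nat factS !natrM; have := fact_neq0 x.
  have x0 : 0 <= x%:R :> rat by rewrite ler0n.
  move: (x`!%:R : rat) => f f0; rewrite fact0; field; rewrite f0 /=; apply: lt0r_neq0; lra.
transitivity (\det (\matrix_(a < n, b < n) ((3 * a + 2 * x + 5)%:R *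
    (\matrix_(a, b) mrr (x + 2) a b : 'M[rat]_n) a b))).
  congr (\det _); apply/matrixP => i j; rewrite !mxE pairing_even /= /mrr !add1n.
  rewrite (_ : 3 * i.+1 + 2 * x + 2 = 3 * i + 2 * x + 5)%N; last by lia.
  rewrite (_ : i.+1 + j.+1 + x = i + j + (x + 2))%N; last by lia.
  by congr (_ * (_ * ifact _ * ifact _)); lia.
by rewrite det_scale_rows det_mrr; [rewrite -big_split; apply: eq_bigr | lia].
Qed.

Lemma det_pairing_odd n :
  \det (\matrix_(a < n, b < n) pairing x (2 * a + 1) (2 * b + 1)) =
  \prod_(k < n) odd_factor k.
Proof.
transitivity (\det (\matrix_(a < n, b < n) ((3 * b + x + 3)%:R *
    (\matrix_(a, b) mrr (x + 1) a b : 'M[rat]_n) a b))).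
  congr (\det _); apply/matrixP => i j; rewrite !mxE pairing_odd /mrr.
  rewrite (_ : i + j + x + 1 = i + j + (x + 1))%N; last by lia.
  by congr (_ * (_ * ifact _ * ifact _)); lia.
by rewrite det_scale_cols det_mrr; [rewrite -big_split; apply: eq_bigr | lia].
Qed.

Lemma CS_even n : (CS (2 * n.+1) (2 * x + 1))%:R =
  2 * (\prod_(k < n) even_factor k) * \prod_(k < n.+1) odd_factor k.
Proof.
rewrite (_ : 2 * n.+1 = n.+1 + n.+1)%N; last by lia.
rewrite CS_det; last by lia.
rewrite det_binomial_split; last by lia.
by rewrite det_pairing_even det_pairing_odd.
Qed.

Lemma CS_odd n : (CS (2 * n.+1 - 1) (2 * x + 1))%:R =
  2 * (\prod_(k < n) even_factor k) * \prod_(k < n) odd_factor k.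
Proof.
rewrite (_ : 2 * n.+1 - 1 = n.+1 + n)%N; last by lia.
rewrite CS_det; last by lia.
rewrite det_binomial_split; last by lia.
by rewrite det_pairing_even det_pairing_odd.
Qed.

Hypothesis x_gt0 : (0 < x)%N.

(** * Comparison of the determinants with the product formulas *)

Definition shifted_poch i : rat := poch (2 * x + 2 * i)%:R i.
Definition even_formula n : rat :=
  (n`! * (x - 1)`!)%:R / ((2 * n)`!)%:R
     * (\prod_(0 <= i < n.+1)
          (poch (x + 2 * i)%:R (i + 1) / ((x + n + i)`!)%:R))
     * \prod_(0 <= i < n)
          ((i`!)%:R ^+ 2 * poch (2 * x + 2 * i + 2)%:R (i + 1) ^+ 2
           * ((x + i)`!)%:R * poch (x + 2 * i + 1)%:R i
           / ((2 * i)`!)%:R ^+ 2).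
Definition odd_formula n : rat :=
  ((x - 1)`!)%:R * poch (2 * x + 2 * n)%:R n / ((x + n - 1)`!)%:R
     * \prod_(0 <= i < n)
          ((i`!)%:R ^+ 2 * poch (2 * x + 2 * i)%:R i ^+ 2
           * ((x + i)`!)%:R * poch (x + 2 * i)%:R (i + 1)
           * poch (x + 2 * i + 1)%:R i
           / (((2 * i)`!)%:R ^+ 2 * ((x + n + i)`!)%:R)).

Lemma poch_fact m k : (0 < m)%N -> poch (m%:R : rat) k = (m + k - 1)`!%:R / (m - 1)`!%:R.
Proof.
move=> m0; elim: k => [|k IH]; first by rewrite /poch big_ord0 addn0 divff ?fact_neq0.
rewrite /poch big_ord_recr /= -/(poch _ _) IH -natrD.
rewrite (_ : m + k.+1 - 1 = (m + k - 1).+1)%N; last by lia.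
rewrite factS natrM (_ : (m + k - 1).+1 = m + k)%N; last by lia.
by rewrite mulrC mulrA.
Qed.

Definition tail_factor i : rat :=
  (i`!)%:R ^+ 2 * ((x + i)`!)%:R * poch (x + 2 * i + 1)%:R i / ((2 * i)`!)%:R ^+ 2.

(** Separating the products lets the long ones cancel between the two formulas. The squared factor
    at i is that of [shifted_poch] at i + 1, and the extra term at 0 is 1. *)
Lemma even_formulaE n : even_formula n =
  (n`!%:R * (x - 1)`!%:R) / ((2 * n)`!)%:R
  * (\prod_(0 <= i < n.+1) poch (x + 2 * i)%:R (i + 1))
  * (\prod_(0 <= i < n.+1) (x + n + i)`!%:R)^-1
  * (\prod_(0 <= i < n) tail_factor i) * (\prod_(0 <= i < n.+1) shifted_poch i) ^+ 2.
Proof.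
rewrite /even_formula big_split prodfV /= natrM -!mulrA.
do 5!congr (_ * _).
transitivity (\prod_(0 <= i < n) (tail_factor i * shifted_poch i.+1 ^+ 2)).
  apply: eq_big_nat => i _; rewrite /tail_factor /shifted_poch !addn1.
  by rewrite (_ : 2 * x + 2 * i.+1 = 2 * x + 2 * i + 2)%N; [ring | lia].
rewrite big_split /= prodrXl; congr (_ * _ ^+ 2).
have h0 : shifted_poch 0 = 1 by rewrite /shifted_poch /poch big_ord0.
by rewrite [RHS]big_nat_recl // h0 mul1r.
Qed.

Lemma odd_formulaE n : odd_formula n =
  ((x - 1)`!)%:R * shifted_poch n / ((x + n - 1)`!)%:R
  * (\prod_(0 <= i < n) poch (x + 2 * i)%:R (i + 1))
  * (\prod_(0 <= i < n) (x + n + i)`!%:R)^-1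
  * (\prod_(0 <= i < n) tail_factor i) * (\prod_(0 <= i < n) shifted_poch i) ^+ 2.
Proof.
rewrite /odd_formula -!mulrA; do 3!congr (_ * _).
rewrite -prodfV -prodrXl -!big_split /=; apply: eq_big_nat => i _.
rewrite /tail_factor /shifted_poch invfM; ring.
Qed.

(** Passing from size 2n + 1 to size 2n + 2 adds one pivot of the odd block. The long products agree
    up to their last terms, so only a few factorials remain to be compared. *)
Lemma even_formula_odd n : even_formula n.+1 = odd_formula n.+1 * odd_factor n.
Proof.
rewrite even_formulaE odd_formulaE.
rewrite [\prod_(0 <= i < n.+2) poch _ _]big_nat_recr //=.
rewrite [\prod_(0 <= i < n.+2) (_`!)%:R]big_nat_recr //=.
rewrite [\prod_(0 <= i < n.+2) shifted_poch _]big_nat_recr //=.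
set A := \prod_(0 <= i < n.+1) poch _ _; set B := \prod_(0 <= i < n.+1) (_`!)%:R.
set C := \prod_(0 <= i < n.+1) tail_factor _; set H := \prod_(0 <= i < n.+1) shifted_poch _.
have B0 : B != 0 by rewrite /B prodf_seq_neq0; apply/allP => i _ /=; rewrite fact_neq0.
rewrite /shifted_poch !poch_fact; try lia.
rewrite /odd_factor /mrr_ratio.
rewrite (_ : x + 2 * n.+1 + (n.+1 + 1) - 1 = (x + 3 * n + 2).+1)%N; last by lia.
rewrite (_ : x + 1 + 3 * n + 1 = x + 3 * n + 2)%N; last by lia.
rewrite (_ : x + n.+1 + n.+1 = x + 2 * n.+1)%N; last by lia.
rewrite (_ : x + 1 + n - 1 = x + n.+1 - 1)%N; last by lia.
rewrite (_ : 2 * (x + 1) + 3 * n = 2 * x + 2 * n.+1 + n.+1 - 1)%N; last by lia.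
rewrite (_ : x + 1 + 2 * n + 1 = x + 2 * n.+1)%N; last by lia.
rewrite (_ : x + 1 + 2 * n = x + 2 * n.+1 - 1)%N; last by lia.
rewrite (_ : 2 * (x + 1) + 2 * n - 1 = 2 * x + 2 * n.+1 - 1)%N; last by lia.
rewrite (_ : 2 * n + 2 = 2 * n.+1)%N; last by lia.
rewrite (factS (x + 3 * n + 2)) natrM.
have n1 := fact_neq0 (2 * n.+1); have n2 := fact_neq0 (x + 2 * n.+1 - 1).
have n3 := fact_neq0 (x + 2 * n.+1); have n4 := fact_neq0 (2 * x + 2 * n.+1 - 1).
have n5 := fact_neq0 (x + n.+1 - 1).
move: ((2 * n.+1)`!%:R : rat) ((x + 2 * n.+1 - 1)`!%:R : rat) ((x + 2 * n.+1)`!%:R : rat)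
  ((2 * x + 2 * n.+1 - 1)`!%:R : rat) ((x + n.+1 - 1)`!%:R : rat) n1 n2 n3 n4 n5
  ((x - 1)`!%:R : rat) (n.+1`!%:R : rat) ((x + 3 * n + 2)`!%:R : rat)
  ((2 * x + 2 * n.+1 + n.+1 - 1)`!%:R : rat)
  => f1 f2 f3 f4 f5 n1 n2 n3 n4 n5 g1 g2 g3 g4.
by field; rewrite n1 n2 n3 n4 n5 B0.
Qed.

Lemma odd_formula_even n : odd_formula n.+2 = even_formula n.+1 * even_factor n.
Proof.
rewrite even_formulaE odd_formulaE.
rewrite [\prod_(0 <= i < n.+2) tail_factor _]big_nat_recr //=.
rewrite [\prod_(0 <= i < n.+2) (x + n.+2 + i)`!%:R]big_nat_recr //=.
(* The two factorial products are shifted by one: removing the first term here and the last term of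
   the other leaves the same product. *)
rewrite [\prod_(0 <= i < n.+2) (x + n.+1 + i)`!%:R]big_nat_recl //=.
have -> : \prod_(0 <= i < n.+1) (x + n.+1 + i.+1)`!%:R =
    \prod_(0 <= i < n.+1) (x + n.+2 + i)`!%:R :> rat.
  by apply: eq_big_nat => i _; congr (_`!%:R); lia.
set A := \prod_(0 <= i < n.+2) poch _ _; set B := \prod_(0 <= i < n.+1) (_`!)%:R.
set C := \prod_(0 <= i < n.+1) tail_factor _; set H := \prod_(0 <= i < n.+2) shifted_poch _.
have B0 : B != 0 by rewrite /B prodf_seq_neq0; apply/allP => i _ /=; rewrite fact_neq0.
rewrite /tail_factor /shifted_poch !poch_fact; try lia.
rewrite /even_factor /mrr_ratio.
rewrite (_ : 2 * x + 2 * n.+2 + n.+2 - 1 = (2 * x + 3 * n + 4).+1)%N; last by lia.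
rewrite (_ : 2 * x + 2 * n.+2 - 1 = 2 * x + 2 * n + 3)%N; last by lia.
rewrite (_ : x + n.+2 - 1 = x + n + 1)%N; last by lia.
rewrite (_ : x + n.+1 + 0 = x + n + 1)%N; last by lia.
rewrite (_ : x + n.+1 = x + n + 1)%N; last by lia.
rewrite (_ : x + n.+2 + n.+1 = x + 2 * n + 3)%N; last by lia.
rewrite (_ : x + 2 * n.+1 + 1 + n.+1 - 1 = x + 3 * n + 3)%N; last by lia.
rewrite (_ : x + 2 * n.+1 + 1 - 1 = x + 2 * n + 2)%N; last by lia.
rewrite (_ : x + 2 + 3 * n + 1 = x + 3 * n + 3)%N; last by lia.
rewrite (_ : x + 2 + n - 1 = x + n + 1)%N; last by lia.
rewrite (_ : 2 * (x + 2) + 3 * n = 2 * x + 3 * n + 4)%N; last by lia.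
rewrite (_ : x + 2 + 2 * n + 1 = x + 2 * n + 3)%N; last by lia.
rewrite (_ : x + 2 + 2 * n = x + 2 * n + 2)%N; last by lia.
rewrite (_ : 2 * (x + 2) + 2 * n - 1 = 2 * x + 2 * n + 3)%N; last by lia.
rewrite (_ : 2 * n + 2 = 2 * n.+1)%N; last by lia.
rewrite (factS (2 * x + 3 * n + 4)) natrM.
have n1 := fact_neq0 (2 * n.+1); have n2 := fact_neq0 (x + 2 * n + 2).
have n3 := fact_neq0 (x + 2 * n + 3); have n4 := fact_neq0 (2 * x + 2 * n + 3).
have n5 := fact_neq0 (x + n + 1).
move: ((2 * n.+1)`!%:R : rat) ((x + 2 * n + 2)`!%:R : rat) ((x + 2 * n + 3)`!%:R : rat)
  ((2 * x + 2 * n + 3)`!%:R : rat) ((x + n + 1)`!%:R : rat) n1 n2 n3 n4 n5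
  ((x - 1)`!%:R : rat) (n.+1`!%:R : rat) ((x + 3 * n + 3)`!%:R : rat)
  ((2 * x + 3 * n + 4)`!%:R : rat)
  => f1 f2 f3 f4 f5 n1 n2 n3 n4 n5 g1 g2 g3 g4.
by field; rewrite n1 n2 n3 n4 n5 B0.
Qed.

Lemma odd_formula1 : odd_formula 1 = 2.
Proof.
rewrite /odd_formula big_nat1 !muln0 !addn0 /poch !big_ord0 !big_ord1 !addr0.
rewrite (_ : x + 1 - 1 = (x - 1).+1)%N; last by lia.
rewrite (_ : x + 1 = (x - 1).+2)%N; last by lia.
have [w xE] : exists w, x = w.+1 by exists x.-1; lia.
rewrite xE subn1 /= !factS !fact0; have n1 := fact_neq0 w.
have w0 : 0 <= w%:R :> rat by rewrite ler0n.
rewrite !natrM; move: (w`!%:R : rat) n1 => f n1; field; rewrite n1 /=.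
by do ?[apply/andP; split]=> //; apply: lt0r_neq0; lra.
Qed.

(** The two one-step relations alternate, starting from the value 2, which is also the 1 by 1 even
    block. *)
Lemma formulas_prod n :
  odd_formula n.+1 = 2 * (\prod_(k < n) even_factor k) * \prod_(k < n) odd_factor k
  /\ even_formula n.+1 = 2 * (\prod_(k < n) even_factor k) * \prod_(k < n.+1) odd_factor k.
Proof.
have evenE m : odd_formula m.+1 =
    2 * (\prod_(k < m) even_factor k) * \prod_(k < m) odd_factor k ->
    even_formula m.+1 = 2 * (\prod_(k < m) even_factor k) * \prod_(k < m.+1) odd_factor k.
  by move=> oE; rewrite even_formula_odd oE -mulrA [\prod_(k < m.+1) odd_factor k]big_ord_recr.
suff oddE : odd_formula n.+1 =
    2 * (\prod_(k < n) even_factor k) * \prod_(k < n) odd_factor k by split; auto.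
elim: n => [|n IH]; first by rewrite odd_formula1 !big_ord0 !mulr1.
rewrite odd_formula_even (evenE _ IH) [\prod_(k < n.+1) even_factor k]big_ord_recr /=.
by rewrite mulrAC !mulrA.
Qed.

End Assembly.

Theorem theorem3p2 (n x : nat) (hn : (1 <= n)%N) (hx : (1 <= x)%N) :
  (CS (2 * n) (2 * x + 1))%:R =
    ((n`! * (x - 1)`!)%:R / ((2 * n)`!)%:R
     * (\prod_(0 <= i < n.+1)
          (poch (x + 2 * i)%:R (i + 1) / ((x + n + i)`!)%:R))
     * \prod_(0 <= i < n)
          ((i`!)%:R ^+ 2 * poch (2 * x + 2 * i + 2)%:R (i + 1) ^+ 2
           * ((x + i)`!)%:R * poch (x + 2 * i + 1)%:R i
           / ((2 * i)`!)%:R ^+ 2)) :> rat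
  /\
  (CS (2 * n - 1) (2 * x + 1))%:R =
    (((x - 1)`!)%:R * poch (2 * x + 2 * n)%:R n / ((x + n - 1)`!)%:R
     * \prod_(0 <= i < n)
          ((i`!)%:R ^+ 2 * poch (2 * x + 2 * i)%:R i ^+ 2
           * ((x + i)`!)%:R * poch (x + 2 * i)%:R (i + 1)
           * poch (x + 2 * i + 1)%:R i
           / (((2 * i)`!)%:R ^+ 2 * ((x + n + i)`!)%:R))) :> rat.
Proof.
case: n hn => // n _; have [oddE evenE] := formulas_prod hx n.
by split; [rewrite CS_even -evenE | rewrite CS_odd -oddE].
Qed.
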